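(* Let $G\in\mathcal{C}$. Let $\Sigma$ be a pyramid in $G$ with paths $P_1,P_2,P_3$, apex $a$ and base $b_1b_2b_3$, and let $i,j\in\{1,2,3\}$ be distinct. For $l\in\{1,2,3\}$ let $a_l$ be the neighbor of $a$ in $P_l$. Let $P$ be a path in $G$ from a vertex of $P_i\setminus\{a,a_i,b_i\}$ to a vertex of $P_j\setminus\{a,a_j,b_j\}$. Then at least one of $a,b_1,b_2,b_3$ has a neighbor in $P^*$.
   Context: Graphs are finite and simple; a path in $G$ is an induced subgraph that is a path, and $P^*$ denotes the interior of $P$ (all vertices except its two ends). $\mathcal{C}$ is the class of graphs with no induced subgraph isomorphic to $C_4$, a theta (three internally disjoint paths of length $\ge2$ between two vertices with pairwise anticomplete interiors), a prism (three vertex-disjoint paths $a_i\cdots b_i$ of length $\ge1$ with $a_1a_2a_3$, $b_1b_2b_3$ triangles and no other edges between them), or an even wheel (a hole, i.e. induced cycle of length $\ge4$, plus a vertex with an even number, at least 4, of neighbors in it). A pyramid is a graph consisting of three paths $P_1=a\cdots b_1$, $P_2=a\cdots b_2$, $P_3=a\cdots b_3$ such that $P_1\setminus\{a\},P_2\setminus\{a\},P_3\setminus\{a\}$ are pairwise disjoint, at least two of the three paths have length at least two, $b_1b_2b_3$ is a triangle (the base), and there are no edges between $P_1\setminus\{a\},P_2\setminus\{a\},P_3\setminus\{a\}$ except those of the triangle; $a$ is the apex. *)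

(* Defs.v *)
From mathcomp Require Import all_boot.
Set Implicit Arguments.
Unset Strict Implicit.
Unset Printing Implicit Defensive.

(* A finite simple graph is a symmetric irreflexive relation [e] on a finite
   type of vertices.  Subgraphs are induced throughout; "G has an induced
   subgraph isomorphic to H" is rendered by listing the vertices of a copy
   of H in G. *)

Section Graphs.

Variables (T : finType) (e : rel T).

(* The sequence lists the vertices in path order, both ends included; the
   one-vertex path is allowed. *)
Definition induced_path (u v : T) (p : seq T) : Prop :=
  [/\ ohead p = Some u, last u p = v, uniq p &
      {in p &, forall x y,
         e x y = (index y p == (index x p).+1) || (index x p == (index y p).+1)}].

Definition path_length (p : seq T) : nat := (size p).-1.

Definition interior (u v : T) (p : seq T) : {set T} :=
  [set x in p | (x != u) && (x != v)].

(* [next c x] is the cyclic successor of [x] in [c]. *)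
Definition hole (c : seq T) : Prop :=
  [/\ 4 <= size c, uniq c &
      {in c &, forall x y, e x y = (y == next c x) || (x == next c y)}].

Definition anticomplete (A B : {set T}) : Prop :=
  {in A & B, forall x y, ~~ e x y}.

Definition triangle (t : 'I_3 -> T) : Prop :=
  forall i j, i != j -> e (t i) (t j).

Definition has_neighbor_in (x : T) (A : {set T}) : Prop :=
  exists2 y, y \in A & e x y.

Definition theta (u v : T) (P : 'I_3 -> seq T) : Prop :=
  (forall i, induced_path u v (P i) /\ 2 <= path_length (P i)) /\
  (forall i j, i != j ->
     [disjoint interior u v (P i) & interior u v (P j)] /\
     anticomplete (interior u v (P i)) (interior u v (P j))).

Definition prism (a b : 'I_3 -> T) (P : 'I_3 -> seq T) : Prop :=
  [/\ forall i, induced_path (a i) (b i) (P i) /\ 1 <= path_length (P i),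
      forall i j, i != j -> [disjoint P i & P j],
      triangle a, triangle b &
      forall i j x y, i != j -> x \in P i -> y \in P j -> e x y ->
        (x = a i /\ y = a j) \/ (x = b i /\ y = b j)].

Definition even_wheel (c : seq T) (w : T) : Prop :=
  [/\ hole c, w \notin c, 4 <= count (e w) c & ~~ odd (count (e w) c)].

Definition in_class_C : Prop :=
  [/\ forall c, hole c -> size c <> 4,
      forall u v P, ~ theta u v P,
      forall a b P, ~ prism a b P &
      forall c w, ~ even_wheel c w].

Definition pyramid (a : T) (b : 'I_3 -> T) (P : 'I_3 -> seq T) : Prop :=
  let Q i : {set T} := [set x in P i] :\ a in
  [/\ forall i, induced_path a (b i) (P i),
      forall i j, i != j -> [disjoint Q i & Q j],
      2 <= #|[set i | 2 <= path_length (P i)]|,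
      triangle b &
      forall i j x y, i != j -> x \in Q i -> y \in Q j -> e x y ->
        x = b i /\ y = b j].

End Graphs.

(* Main.v *)
Require Import Defs.
From mathcomp Require Import all_boot zify.
Set Implicit Arguments.
Unset Strict Implicit.
Unset Printing Implicit Defensive.

(** Suppose that [a] and the [b l] have no neighbour in the interior of [P], and
    let [X = x_1 ... x_m] be a shortest subpath of that interior whose ends have
    neighbours in [P_s \ {a, a_s, b_s}] and [P_t \ {a, a_t, b_t}] for some
    [s <> t]; write [r] for the third index.  By minimality [X] is disjoint from
    the pyramid and, when [m > 1], the [a_l] are the only further neighbours in
    the pyramid of the vertices of [X]; since there is no [C_4], a vertex of [X]
    sees at most one [a_l].  Closing [X] through the base edge [b_s b_t] gives a
    hole [Y] that avoids [a].  Three legs lead from [a] to [Y], along [P_s],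
    [P_t] and [P_r], the last one ending in the two adjacent contacts [b_s],
    [b_t] of [b_r] unless [a_r] itself has neighbours in [X].  Comparing the
    positions on [Y] of the contacts of the legs produces in every case a theta
    or a prism.

    Thetas and prisms are never built from explicit paths: it is enough to
    exhibit pairwise disjoint connected sets with no unwanted edges between
    them, since shortest paths inside these sets are induced. *)

(** * Thetas and prisms from connected sets *)

Section Links.

Variables (T : finType) (e : rel T).
Hypotheses (e_sym : symmetric e) (e_irr : irreflexive e).

Definition sep (A B : {set T}) : Prop :=
  forall x y, x \in A -> y \in B -> x <> y /\ ~ e x y.

Lemma sep_sym A B : sep A B -> sep B A.
Proof.
by move=> s x y Ax By; have [ne nadj] := s y x By Ax; split;
  [exact/nesym | rewrite e_sym].
Qed.

Lemma sepUl A B C : sep A C -> sep B C -> sep (A :|: B) C.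
Proof. by move=> sA sB x y /setUP[Ax|Bx] Cy; [apply: sA | apply: sB]. Qed.

Lemma sepUr A B C : sep A B -> sep A C -> sep A (B :|: C).
Proof. by move=> sB sC x y Ax /setUP[By|Cy]; [apply: sB | apply: sC]. Qed.

(** Reachability in the subgraph induced on [A]. Since [connect] is reflexive, [link A x x] holds
    even outside [A], so membership of the starting point is asked for separately where it
    matters. *)
Definition link (A : {set T}) : rel T :=
  connect [rel x y | [&& x \in A, y \in A & e x y]].

Lemma link_trans (A : {set T}) x y z : link A x y -> link A y z -> link A x z.
Proof. exact: connect_trans. Qed.

Lemma link_sym (A : {set T}) x y : link A x y -> link A y x.
Proof.
have: connect_sym [rel x y | [&& x \in A, y \in A & e x y]].
  by apply: sym_connect_sym => u v /=; rewrite e_sym andbCA.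
by rewrite /link => ->.
Qed.

Lemma link_step (A : {set T}) x y z :
  x \in A -> y \in A -> e x y -> link A y z -> link A x z.
Proof. by move=> Ax Ay exy; apply/connect_trans/connect1/and3P. Qed.

(** [minn] and [maxn] delimit the stretch whether the indices go up or down, so a leg or an arc can
    be followed in both directions. *)
Lemma link_run (A : {set T}) (p : nat -> T) i j z :
  (forall d, minn i j <= d < maxn i j -> e (p d) (p d.+1)) ->
  (forall d, minn i j <= d <= maxn i j -> p d \in A) ->
  link A (p j) z -> link A (p i) z.
Proof.
move=> adj inA; apply: link_trans.
have up n h : (forall d, h <= d < h + n -> e (p d) (p d.+1)) ->
    (forall d, h <= d <= h + n -> p d \in A) -> link A (p h) (p (h + n)).
  elim: n h => [|n IHn] h adj_h in_h; first by rewrite addn0; apply: connect0.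
  rewrite addnS -addSn; apply: (link_step (y := p h.+1)).
  - by apply: in_h; lia.
  - by apply: in_h; lia.
  - by apply: adj_h; lia.
  by apply: IHn => d ?; [apply: adj_h | apply: in_h]; lia.
have [le_ij|lt_ji] := leqP i j.
  by rewrite -(subnKC le_ij); apply: up => d ?; [apply: adj | apply: inA]; lia.
apply: link_sym; rewrite -(subnKC (ltnW lt_ji)).
by apply: up => d ?; [apply: adj | apply: inA]; lia.
Qed.

(** A shortest walk inside [A] is chordless, because a chord would give a shorter one. *)
Lemma link_induced_path (A : {set T}) u v :
  u \in A -> link A u v ->
  exists2 p, induced_path e u v p & {subset p <= A}.
Proof.
move=> Au linked; pose r := [rel x y | [&& x \in A, y \in A & e x y]].
pose joins n := [exists t : n.-tuple T, path r u t && (last u t == v)].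
have joinsP q : path r u q -> last u q = v -> joins (size q).
  by move=> rq vE; apply/existsP; exists (in_tuple q); rewrite rq vE eqxx.
have ex_joins : exists n, joins n.
  by have /connectP[q rq vE] := linked; exists (size q); apply: joinsP.
case: (ex_minnP ex_joins) => n /existsP[t /andP[]].
(* Deleting repetitions does not lengthen a walk, so [q] still has minimal length. *)
case/shortenP => q rq uq sub_qt /eqP vE min_n.
have {min_n} [m mE min_n] : exists2 m, size q = m &
    forall q', path r u q' -> last u q' = v -> m <= size q'.
  exists (size q) => // q' rq' vE'; apply: leq_trans (min_n _ (joinsP _ rq' vE')).
  by rewrite -(size_tuple t); apply: uniq_leq_size sub_qt; case/andP: uq.
have adj d : d < m -> r (nth u (u :: q) d) (nth u (u :: q) d.+1).
  by rewrite -mE => lt_d; apply: (pathP u rq).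
have inA d : d <= m -> nth u (u :: q) d \in A.
  by case: d => [|d] // /adj /and3P[].
have no_chord i j : i.+1 < j -> j <= m ->
    ~~ e (nth u (u :: q) i) (nth u (u :: q) j).
  move=> lt_ij le_j; apply/negP => chord.
  have last_take d : d <= m -> last u (take d q) = nth u (u :: q) d.
    move=> le_d; rewrite (last_nth u) size_takel ?mE //.
    by case: d le_d => //= d _; rewrite nth_take.
  have le_i : i <= m by lia.
  have qj : j.-1 < size q by rewrite mE; lia.
  have j1 : j.-1.+1 = j by lia.
  (* The chord bypasses what lies strictly between positions [i] and [j] of [u :: q]; position [j]
     there is position [j.-1] of [q]. *)
  have /min_n : path r u (take i q ++ drop j.-1 q).
    rewrite cat_path take_path //= last_take //.
    rewrite (drop_nth u qj) /= j1.
    have -> : nth u q j.-1 = nth u (u :: q) j by case: (j) lt_ij.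
    rewrite !inA // chord /=.
    have := rq; rewrite -{1}(cat_take_drop j q) cat_path => /andP[_].
    by rewrite last_take.
  rewrite last_cat size_cat size_takel ?mE // size_drop mE.
  have -> : last (last u (take i q)) (drop j.-1 q) = v.
    rewrite -vE -[in RHS](cat_take_drop j.-1 q) last_cat.
    by rewrite (drop_nth u qj).
  by move=> /(_ erefl); lia.
exists (u :: q); last first.
  by move=> x /(nthP u)[d]; rewrite /= mE ltnS => le_d <-; apply: inA.
split=> // x y /(nthP u)[i lt_i <-] /(nthP u)[j lt_j <-].
rewrite !index_uniq //; move: lt_i lt_j; rewrite /= mE !ltnS => le_i le_j.
have [lt_ij|lt_ji|->] := ltngtP i j.
- have [jE|ne] := eqVneq j i.+1.
    by rewrite {1}jE; case/and3P: (adj i ltac:(lia)).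
  by rewrite (negbTE (no_chord _ _ _ _)); lia.
- rewrite e_sym; have [iE|ne] := eqVneq i j.+1.
    by rewrite {1}iE orbT; case/and3P: (adj j ltac:(lia)).
  by rewrite (negbTE (no_chord _ _ _ _)); lia.
by rewrite e_irr; lia.
Qed.

Definition ord3 (X : Type) (x y z : X) (i : 'I_3) : X := nth x [:: x; y; z] i.

(** Shortest paths have their interiors in [A], [B] and [C], and non-adjacency of [u] and [v] makes
    them of length at least 2. *)
Lemma theta_of_links (u v : T) (A B C : {set T}) :
  (forall x y P, ~ theta e x y P) ->
  u <> v -> ~ e u v -> sep A B -> sep A C -> sep B C ->
  link (u |: (v |: A)) u v -> link (u |: (v |: B)) u v ->
  link (u |: (v |: C)) u v -> False.
Proof.
move=> no_theta ne nadj sAB sAC sBC.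
have path_in (S : {set T}) : link (u |: (v |: S)) u v ->
    exists2 p, induced_path e u v p & interior u v p \subset S.
  move=> /link_induced_path[|p ip sub_p]; first by rewrite setU11.
  exists p => //; apply/subsetP => x; rewrite !inE => /and3P[/sub_p].
  by rewrite !inE => /or3P[-> | -> | ->].
move=> /path_in[p ip sp] /path_in[q iq sq] /path_in[r ir sr].
have long_p p' : induced_path e u v p' -> 2 <= path_length p'.
  rewrite /path_length => -[hd lst uq adj].
  case: p' hd lst uq adj => [|x [|y [|z p']]] //= [->] // -> // _.
  move=> /(_ u v); rewrite !inE !eqxx orbT => /(_ isT isT).
  by rewrite (negbTE (introN eqP ne)) => adj_uv; case: nadj; rewrite adj_uv.
pose S := ord3 A B C; pose P := ord3 p q r.
have sS i j : i != j -> sep (S i) (S j).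
  rewrite /S /ord3 -val_eqE.
  by case: i j => [[|[|[|?]]] ?] [[|[|[|?]]] ?] //= _; try exact: sep_sym.
have sP i : interior u v (P i) \subset S i.
  by rewrite /S /P /ord3; case: i => [[|[|[|?]]] ?].
apply: (no_theta u v P); split=> [i|i j ne_ij].
  by rewrite /P /ord3; case: i => [[|[|[|?]]] ?] //=; split=> //; apply: long_p.
split.
  apply/pred0P => x /=; apply/negP => /andP[xi xj].
  by have [] := sS _ _ ne_ij x x (subsetP (sP i) _ xi) (subsetP (sP j) _ xj).
move=> x y xi xj; apply/negP => exy.
by have [_] := sS _ _ ne_ij x y (subsetP (sP i) _ xi) (subsetP (sP j) _ xj).
Qed.

(** The analogue of [sep] for two paths of a prism, whose only cross edges lie in the two
    triangles. *)
Definition meets_only_at (a1 b1 a2 b2 : T) (A B : {set T}) : Prop :=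
  forall x y, x \in A -> y \in B ->
    x <> y /\ (e x y -> (x = a1 /\ y = a2) \/ (x = b1 /\ y = b2)).

Lemma prism_of_links (a1 a2 a3 b1 b2 b3 : T) (A B C : {set T}) :
  (forall x y P, ~ prism e x y P) ->
  [/\ e a1 a2, e a1 a3 & e a2 a3] -> [/\ e b1 b2, e b1 b3 & e b2 b3] ->
  [/\ a1 <> b1, a2 <> b2 & a3 <> b3] ->
  meets_only_at a1 b1 a2 b2 A B -> meets_only_at a1 b1 a3 b3 A C ->
  meets_only_at a2 b2 a3 b3 B C ->
  [/\ a1 \in A, a2 \in B & a3 \in C] ->
  link A a1 b1 -> link B a2 b2 -> link C a3 b3 -> False.
Proof.
move=> no_prism [ea12 ea13 ea23] [eb12 eb13 eb23] [ne1 ne2 ne3] mAB mAC mBC.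
move=> [a1A a2B a3C] /link_induced_path[//|p ip sp] /link_induced_path[//|q iq sq].
move=> /link_induced_path[//|r ir sr].
have long_p x y p' : x <> y -> induced_path e x y p' -> 1 <= path_length p'.
  by rewrite /path_length => ne [hd lst _ _]; case: p' hd lst => [|z [|]] //= [->].
have m_sym x y z t (D E : {set T}) :
    meets_only_at x y z t D E -> meets_only_at z t x y E D.
  move=> m u v Eu Dv; have [ne H] := m v u Dv Eu; split; first exact/nesym.
  by rewrite e_sym => /H[[-> ->]|[-> ->]]; [left | right].
pose S := ord3 A B C; pose P := ord3 p q r.
pose a := ord3 a1 a2 a3; pose b := ord3 b1 b2 b3.
have mS i j : i != j -> meets_only_at (a i) (b i) (a j) (b j) (S i) (S j).
  rewrite /S /a /b /ord3 -val_eqE.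
  by case: i j => [[|[|[|?]]] ?] [[|[|[|?]]] ?] //= _; try exact: m_sym.
have sP i : {subset P i <= S i}.
  by rewrite /S /P /ord3; case: i => [[|[|[|?]]] ?].
apply: (no_prism a b P); split.
- move=> i; rewrite /P /a /b /ord3.
  by case: i => [[|[|[|?]]] ?] //=; split=> //;
    [exact: long_p ne1 ip | exact: long_p ne2 iq | exact: long_p ne3 ir].
- move=> i j ne_ij; apply/pred0P => x /=; apply/negP => /andP[xi xj].
  by have [] := mS _ _ ne_ij x x (sP i _ xi) (sP j _ xj).
- move=> i j; rewrite /a /ord3 -val_eqE.
  by case: i j => [[|[|[|?]]] ?] [[|[|[|?]]] ?] //= _; rewrite // e_sym.
- move=> i j; rewrite /b /ord3 -val_eqE.
  by case: i j => [[|[|[|?]]] ?] [[|[|[|?]]] ?] //= _; rewrite // e_sym.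
move=> i j x y ne_ij xi yj exy.
by have [_] := mS _ _ ne_ij x y (sP i _ xi) (sP j _ yj); apply.
Qed.

Lemma no_square (x y z t : T) :
  (forall c, hole e c -> size c <> 4) ->
  x <> z -> y <> t -> ~ e x z -> ~ e y t ->
  e x y -> e y z -> e z t -> e t x -> False.
Proof.
move=> no_C4 /eqP/negbTE nxz /eqP/negbTE nyt /negP/negbTE exz /negP/negbTE eyt exy eyz ezt etx.
have ne p q : e p q -> (p == q) = false.
  by move=> epq; apply/eqP => pq; rewrite pq e_irr in epq.
have [nxy nyz nzt ntx] := And4 (ne _ _ exy) (ne _ _ eyz) (ne _ _ ezt) (ne _ _ etx).
apply: (no_C4 [:: x; y; z; t]) => //; split=> //.
  by rewrite /= !inE nxy nxz (eq_sym x t) ntx nyz nyt nzt.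
have E := (exy, eyz, ezt, etx, exz, eyt, nxy, nyz, nzt, ntx, nxz, nyt).
have E' := (e_sym y x, e_sym z y, e_sym t z, e_sym x t, e_sym z x, e_sym t y).
have N' := (eq_sym y x, eq_sym z y, eq_sym t z, eq_sym x t, eq_sym z x, eq_sym t y).
move=> p q; rewrite !inE => /or4P[] /eqP-> /or4P[] /eqP->;
  by rewrite /= ?e_irr ?eqxx ?E' ?E ?N' ?E ?eqxx ?N' ?E.
Qed.

End Links.

(** * Contacts of the legs with the hole *)

Lemma extremes (p : pred nat) (B i : nat) : i <= B -> p i ->
  exists n1 n2, [/\ p n1, p n2, n1 <= i <= n2, n2 <= B &
    forall j, j <= B -> p j -> n1 <= j <= n2].
Proof.
move=> le_i pi; pose q j := (j <= B) && p j.
have ex_q : exists j, q j by exists i; rewrite /q le_i.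
have bound_q j : q j -> j <= B by case/andP.
case: (ex_minnP ex_q) => n1 /andP[le1 p1] min1.
case: (ex_maxnP ex_q bound_q) => n2 /andP[le2 p2] max2.
have ext j : j <= B -> p j -> n1 <= j <= n2.
  by move=> le_j pj; rewrite min1 ?max2 // /q le_j.
by exists n1, n2; split=> //; apply: ext.
Qed.

(** To be read with [p d i] saying that vertex [d] of a leg sees [Y i]: [d0] is the first vertex of
    the leg with a contact up to [B], and [n1], [n2] are its outermost contacts. *)
Lemma first_contact (p : nat -> pred nat) (c B d i : nat) :
  d <= c -> i <= B -> p d i ->
  exists d0 n1 n2, [/\ d0 <= c, p d0 n1, p d0 n2, n1 <= n2 <= B &
    forall d' j, d' <= d0 -> j <= B -> p d' j -> d' = d0 /\ n1 <= j <= n2].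
Proof.
move=> le_d le_i pdi; pose q d' := has (p d') (iota 0 B.+1).
have qP d' j : j <= B -> p d' j -> q d'.
  by move=> le_j pj; apply/hasP; exists j => //; rewrite mem_iota.
have ex_q : exists d', q d' by exists d; apply: qP pdi.
case: (ex_minnP ex_q) => d0 /hasP[j0]; rewrite mem_iota => /andP[_ le_j0] pj0 min_d0.
have [n1 [n2 [p1 p2 _ le2 ext]]] := extremes (p := p d0) (B := B) le_j0 pj0.
exists d0, n1, n2; split=> //; first by apply: leq_trans le_d; apply/min_d0/qP/pdi.
  by rewrite le2 andbT; case/andP: (ext _ le2 p2).
move=> d' j le_d' le_j pj; have d'E : d' = d0.
  by apply/eqP; rewrite eqn_leq le_d'; apply/min_d0/qP/pj.
by split=> //; apply: ext; rewrite // -d'E.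
Qed.

(** * Segments of indexed paths and configurations of legs *)

Section Segments.

Variables (T : finType) (e : rel T).

(** Truncated subtraction makes the segment empty when [j < i], so degenerate arcs need no separate
    treatment. *)
Definition seg (p : nat -> T) (i j : nat) : {set T} :=
  [set z in [seq p d | d <- iota i (j.+1 - i)]].

Lemma segP p i j z : reflect (exists2 d, i <= d <= j & z = p d) (z \in seg p i j).
Proof.
rewrite inE; apply: (iffP mapP) => -[d d_ij zE]; exists d => //; move: d_ij;
  by rewrite mem_iota; lia.
Qed.

Lemma in_seg p i j d : i <= d <= j -> p d \in seg p i j.
Proof. by move=> d_ij; apply/segP; exists d. Qed.

Lemma sep_seg p q i j h m :
  (forall d f, i <= d <= j -> h <= f <= m -> p d <> q f /\ ~ e (p d) (q f)) ->
  sep e (seg p i j) (seg q h m).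
Proof. by move=> H _ _ /segP[d d_ij ->] /segP[f f_hm ->]; apply: H. Qed.

Lemma link_refl (A : {set T}) x : link e A x x.
Proof. exact: connect0. Qed.

Lemma meetsUl a1 b1 a2 b2 A B C : meets_only_at e a1 b1 a2 b2 A C ->
  meets_only_at e a1 b1 a2 b2 B C -> meets_only_at e a1 b1 a2 b2 (A :|: B) C.
Proof. by move=> sA sB x y /setUP[Ax|Bx] Cy; [apply: sA | apply: sB]. Qed.

Lemma meetsUr a1 b1 a2 b2 A B C : meets_only_at e a1 b1 a2 b2 A B ->
  meets_only_at e a1 b1 a2 b2 A C -> meets_only_at e a1 b1 a2 b2 A (B :|: C).
Proof. by move=> sB sC x y Ax /setUP[By|Cy]; [apply: sB | apply: sC]. Qed.

Lemma meets_seg a1 b1 a2 b2 p q i j h m :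
  (forall d f, i <= d <= j -> h <= f <= m -> p d <> q f /\
    (e (p d) (q f) -> (p d = a1 /\ q f = a2) \/ (p d = b1 /\ q f = b2))) ->
  meets_only_at e a1 b1 a2 b2 (seg p i j) (seg q h m).
Proof. by move=> H _ _ /segP[d d_ij ->] /segP[f f_hm ->]; apply: H. Qed.

(* [Y 0 .. Y N] is the hole: [Y 0 = b_s], ..., [Y k] on [P_s], then
   [Y k.+1 .. Y l] the path [X], then [Y l.+1], ..., [Y N = b_t] on [P_t].
   [ps], [pt], [pr] are the legs, indexed from the apex, so that [ps 1], [pt 1],
   [pr 1] are its neighbours [a_s], [a_t], [a_r]; [ps] and [pt] stop just before
   [Y], while [pr] runs up to [b_r]. *)
Record leg_config (Y : nat -> T) (N k l : nat) (ps : nat -> T) (cs : nat)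
    (pt : nat -> T) (ct : nat) (pr : nat -> T) (cr : nat) : Prop := LegConfig {
  cf_k : [/\ 0 < k, k < l & l.+1 < N];
  cf_c : [/\ 0 < cs, 0 < ct & 0 < cr];
  cf_Y_inj : forall i j, i <= N -> j <= N -> Y i = Y j -> i = j;
  cf_Y_step : forall i, i < N -> e (Y i) (Y i.+1);
  cf_Y_wrap : e (Y 0) (Y N);
  cf_Y_adj : forall i j, i <= N -> j <= N -> e (Y i) (Y j) ->
    j = i.+1 \/ i = j.+1 \/ (i = 0 /\ j = N) \/ (i = N /\ j = 0);
  cf_t0 : pt 0 = ps 0;
  cf_r0 : pr 0 = ps 0;
  cf_s_step : forall d, d < cs -> e (ps d) (ps d.+1);
  cf_t_step : forall d, d < ct -> e (pt d) (pt d.+1);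
  cf_r_step : forall d, d < cr -> e (pr d) (pr d.+1);
  cf_s_inj : forall d f, d <= cs -> f <= cs -> ps d = ps f -> d = f;
  cf_t_inj : forall d f, d <= ct -> f <= ct -> pt d = pt f -> d = f;
  cf_s_adj : forall d f, d <= cs -> f <= cs -> e (ps d) (ps f) ->
    f = d.+1 \/ d = f.+1;
  cf_t_adj : forall d f, d <= ct -> f <= ct -> e (pt d) (pt f) ->
    f = d.+1 \/ d = f.+1;
  cf_st : forall d f, d <= cs -> 0 < f <= ct ->
    ps d <> pt f /\ (e (ps d) (pt f) -> d = 0 /\ f = 1);
  cf_ts : forall d f, d <= ct -> 0 < f <= cs ->
    pt d <> ps f /\ (e (pt d) (ps f) -> d = 0 /\ f = 1);
  cf_sr : forall d f, d <= cs -> 0 < f <= cr ->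
    ps d <> pr f /\ (e (ps d) (pr f) -> d = 0 /\ f = 1);
  cf_tr : forall d f, d <= ct -> 0 < f <= cr ->
    pt d <> pr f /\ (e (pt d) (pr f) -> d = 0 /\ f = 1);
  cf_Ys : forall i d, i <= N -> d <= cs -> Y i <> ps d /\ (e (Y i) (ps d) ->
    (d = 1 /\ k <= i <= l) \/ (1 < d /\ (i = k \/ i = k.+1)));
  cf_Yt : forall i d, i <= N -> d <= ct -> Y i <> pt d /\ (e (Y i) (pt d) ->
    (d = 1 /\ k < i <= l.+1) \/ (1 < d /\ (i = l \/ i = l.+1)));
  cf_Yr : forall i d, i <= N -> 0 < d <= cr -> Y i <> pr d /\ (e (Y i) (pr d) ->
    (d = cr /\ (i = 0 \/ i = N)) \/ (d = 1 /\ d < cr /\ k < i <= l));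
  cf_Ys_end : e (Y k) (ps cs);
  cf_Yt_end : e (Y l.+1) (pt ct);
  cf_Yr_end : e (Y 0) (pr cr) /\ e (Y N) (pr cr);
  cf_sq_st : forall i, i <= N -> e (Y i) (ps 1) -> e (Y i) (pt 1) -> False;
  cf_sq_sr : forall i, i <= N -> e (Y i) (ps 1) -> e (Y i) (pr 1) -> False;
  cf_sq_tr : forall i, i <= N -> e (Y i) (pt 1) -> e (Y i) (pr 1) -> False
}.

(** Reading [Y] backwards exchanges [P_s] and [P_t]; X moves from positions [k.+1] to [l] to
    positions [N - l] to [N - k.+1]. *)
Lemma leg_config_rev (e_sym : symmetric e) Y N k l ps cs pt ct pr cr :
  leg_config Y N k l ps cs pt ct pr cr ->
  leg_config (fun i => Y (N - i)) N (N - l.+1) (N - k.+1) pt ct ps cs pr cr.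
Proof.
case=> [[k0 kl lN] [cs0 ct0 cr0] Y_inj Y_step Y_wrap Y_adj t0 r0 s_step t_step r_step
  s_inj t_inj s_adj t_adj st ts sr tr Ys Yt Yr Ysk Ytl [Yr0 YrN] sq_st sq_sr sq_tr].
split=> //.
- by split; lia.
- by move=> i j ? ? E; have := Y_inj _ _ (leq_subr _ _) (leq_subr _ _) E; lia.
- move=> i lt_i; rewrite e_sym (_ : N - i = (N - i.+1).+1); last lia.
  by apply: Y_step; lia.
- by rewrite subn0 subnn e_sym.
- by move=> i j ? ? E; have := Y_adj _ _ (leq_subr _ _) (leq_subr _ _) E; lia.
- by rewrite t0.
- move=> i d le_i le_d; have [ne adj] := Yt _ _ (leq_subr i N) le_d.
  by split=> // E; have := adj E; lia.
- move=> i d le_i le_d; have [ne adj] := Ys _ _ (leq_subr i N) le_d.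
  by split=> // E; have := adj E; lia.
- move=> i d le_i le_d; have [ne adj] := Yr _ _ (leq_subr i N) le_d.
  by split=> // E; have := adj E; lia.
- by rewrite (_ : N - _ = l.+1) //; lia.
- by rewrite (_ : N - _ = k) //; lia.
- by rewrite subn0 subnn.
- by move=> i le_i et es; apply: (sq_st _ (leq_subr i N)).
- by move=> i le_i; apply: (sq_tr _ (leq_subr i N)).
- by move=> i le_i; apply: (sq_sr _ (leq_subr i N)).
Qed.

End Segments.

(** * Thetas and prisms in a configuration of legs *)

Section LegConfig.

Variables (T : finType) (e : rel T).
Hypotheses (e_sym : symmetric e) (e_irr : irreflexive e).
Hypotheses (no_theta : forall x y P, ~ theta e x y P)
  (no_prism : forall x y P, ~ prism e x y P).
Variables (Y : nat -> T) (N k l : nat) (ps : nat -> T) (cs : nat)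
  (pt : nat -> T) (ct : nat) (pr : nat -> T) (cr : nat).
Hypothesis cfg : leg_config e Y N k l ps cs pt ct pr cr.

Lemma neYs i d : i <= N -> d <= cs -> Y i <> ps d.
Proof. by move=> le_i le_d; case: (cf_Ys cfg le_i le_d). Qed.
Lemma neYt i d : i <= N -> d <= ct -> Y i <> pt d.
Proof. by move=> le_i le_d; case: (cf_Yt cfg le_i le_d). Qed.
Lemma neYr i d : i <= N -> 0 < d <= cr -> Y i <> pr d.
Proof. by move=> le_i le_d; case: (cf_Yr cfg le_i le_d). Qed.
Lemma neYY i j : i <= N -> j <= N -> i <> j -> Y i <> Y j.
Proof. by move=> le_i le_j ne /(cf_Y_inj cfg le_i le_j). Qed.
Lemma ness d f : d <= cs -> f <= cs -> d <> f -> ps d <> ps f.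
Proof. by move=> le_d le_f ne /(cf_s_inj cfg le_d le_f). Qed.
Lemma nest d f : d <= cs -> 0 < f <= ct -> ps d <> pt f.
Proof. by move=> le_d le_f; case: (cf_st cfg le_d le_f). Qed.
Lemma nets d f : d <= ct -> 0 < f <= cs -> pt d <> ps f.
Proof. by move=> le_d le_f; case: (cf_ts cfg le_d le_f). Qed.
Lemma nesr d f : d <= cs -> 0 < f <= cr -> ps d <> pr f.
Proof. by move=> le_d le_f; case: (cf_sr cfg le_d le_f). Qed.
Lemma netr d f : d <= ct -> 0 < f <= cr -> pt d <> pr f.
Proof. by move=> le_d le_f; case: (cf_tr cfg le_d le_f). Qed.
Lemma adYs i d : i <= N -> d <= cs -> e (Y i) (ps d) ->
  (d = 1 /\ k <= i <= l) \/ (1 < d /\ (i = k \/ i = k.+1)).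
Proof. by move=> le_i le_d; case: (cf_Ys cfg le_i le_d). Qed.
Lemma adYt i d : i <= N -> d <= ct -> e (Y i) (pt d) ->
  (d = 1 /\ k < i <= l.+1) \/ (1 < d /\ (i = l \/ i = l.+1)).
Proof. by move=> le_i le_d; case: (cf_Yt cfg le_i le_d). Qed.
Lemma adYr i d : i <= N -> 0 < d <= cr -> e (Y i) (pr d) ->
  (d = cr /\ (i = 0 \/ i = N)) \/ (d = 1 /\ d < cr /\ k < i <= l).
Proof. by move=> le_i le_d; case: (cf_Yr cfg le_i le_d). Qed.
Lemma adst d f : d <= cs -> 0 < f <= ct -> e (ps d) (pt f) -> d = 0 /\ f = 1.
Proof. by move=> le_d le_f; case: (cf_st cfg le_d le_f). Qed.
Lemma adts d f : d <= ct -> 0 < f <= cs -> e (pt d) (ps f) -> d = 0 /\ f = 1.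
Proof. by move=> le_d le_f; case: (cf_ts cfg le_d le_f). Qed.
Lemma adsr d f : d <= cs -> 0 < f <= cr -> e (ps d) (pr f) -> d = 0 /\ f = 1.
Proof. by move=> le_d le_f; case: (cf_sr cfg le_d le_f). Qed.
Lemma adtr d f : d <= ct -> 0 < f <= cr -> e (pt d) (pr f) -> d = 0 /\ f = 1.
Proof. by move=> le_d le_f; case: (cf_tr cfg le_d le_f). Qed.

Ltac bounds := have [? ? ?] := cf_k cfg; have [? ? ?] := cf_c cfg.

Ltac nat_lia :=
  repeat match goal with
  | H : is_true (e _ _) |- _ => clear H
  | H : ~ is_true (e _ _) |- _ => clear H
  | H : forall _, _ |- _ => clear H
  end; lia.

Ltac ne_base :=
  match goal with
  | |- Y _ <> Y _ => apply: neYY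
  | |- Y _ <> ps _ => apply: neYs
  | |- Y _ <> pt _ => apply: neYt
  | |- Y _ <> pr _ => apply: neYr
  | |- ps _ <> ps _ => apply: ness
  | |- ps _ <> pt _ => first [ apply: nest; nat_lia | apply: nesym; apply: nets ]
  | |- ps _ <> pr _ => apply: nesr
  | |- pt _ <> pr _ => apply: netr
  end; nat_lia.
Ltac ne_tac := first [ ne_base | apply: nesym; ne_base ].

Ltac fact E :=
  match type of E with
  | is_true (e (Y ?i) (Y ?j)) =>
      move: (cf_Y_adj cfg (i := i) (j := j) ltac:(nat_lia) ltac:(nat_lia) E)
  | is_true (e (Y ?i) (ps ?d)) => move: (@adYs i d ltac:(nat_lia) ltac:(nat_lia) E)
  | is_true (e (Y ?i) (pt ?d)) => move: (@adYt i d ltac:(nat_lia) ltac:(nat_lia) E)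
  | is_true (e (Y ?i) (pr ?d)) => move: (@adYr i d ltac:(nat_lia) ltac:(nat_lia) E)
  | is_true (e (ps ?i) (ps ?d)) => move: (cf_s_adj cfg (d := i) (f := d) ltac:(nat_lia) ltac:(nat_lia) E)
  | is_true (e (ps ?i) (pt ?d)) => move: (@adst i d ltac:(nat_lia) ltac:(nat_lia) E)
  | is_true (e (pt ?i) (ps ?d)) => move: (@adts i d ltac:(nat_lia) ltac:(nat_lia) E)
  | is_true (e (ps ?i) (pr ?d)) => move: (@adsr i d ltac:(nat_lia) ltac:(nat_lia) E)
  | is_true (e (pt ?i) (pr ?d)) => move: (@adtr i d ltac:(nat_lia) ltac:(nat_lia) E)
  end.

(** Applies to the edge [E] the contact hypotheses of the current lemma, which take the position on
    the leg before the position on [Y]. *)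
Ltac local_facts E :=
  match type of E with
  | is_true (e (_ ?i) (_ ?d)) =>
      repeat match goal with
      | H : forall _ _ : nat, _ |- _ =>
          move: (H d i ltac:(nat_lia) ltac:(nat_lia) E); clear H
      end
  end.

Ltac adj_tac :=
  let E := fresh "E" in let E' := fresh "E" in
  move=> E; have E' := E; rewrite e_sym in E';
  first [ fact E; local_facts E | fact E'; local_facts E' ]; nat_lia.

Ltac sep_tac :=
  repeat first [ apply: sepUl | apply: sepUr ];
  (apply: sep_seg => ? ? ? ?; (split; [ ne_tac | adj_tac ])).

Ltac mem :=
  first [ exact: set11 | apply: in_seg; nat_lia
        | apply/setUP; left; mem | apply/setUP; right; mem ].

Lemma eYY i j : i <= N -> j <= N -> j = i.+1 \/ i = j.+1 -> e (Y i) (Y j).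
Proof.
move=> le_i le_j [jE|iE]; last rewrite e_sym; subst;
  by apply: (cf_Y_step cfg); nat_lia.
Qed.
Lemma e0t : e (ps 0) (pt 1).
Proof. by rewrite -(cf_t0 cfg); apply: (cf_t_step cfg); bounds. Qed.
Lemma e0r : e (ps 0) (pr 1).
Proof. by rewrite -(cf_r0 cfg); apply: (cf_r_step cfg); bounds. Qed.

Ltac edge_base :=
  first [ assumption | exact: e0t | exact: e0r
    | exact: (cf_Y_wrap cfg) | exact: (cf_Ys_end cfg) | exact: (cf_Yt_end cfg)
    | exact: (proj1 (cf_Yr_end cfg)) | exact: (proj2 (cf_Yr_end cfg))
    | apply: (cf_s_step cfg); nat_lia | apply: (cf_t_step cfg); nat_lia
    | apply: (cf_r_step cfg); nat_lia | apply: eYY; nat_lia ].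
Ltac edge_tac := first [ edge_base | rewrite e_sym; edge_base ].
(* The end of a path is in the union as a singleton, not in its segment. *)
Ltac mem_end :=
  first [ mem | match goal with |- is_true (?p ?d \in ?A) =>
    match A with context [ [set p ?n] ] => have [->|?] := eqVneq d n; mem end end ].
Ltac step z := apply: (link_step (y := z)); [ mem_end | mem_end | edge_tac | ].
Ltac run p0 i0 j0 :=
  apply: (@link_run _ e e_sym _ p0 i0 j0);
  [ let d := fresh "d" in move=> d ?; edge_tac
  | let d := fresh "d" in move=> d ?; mem_end | ].
Ltac stop := exact: link_refl.

(** Here and in [find_prism], the side conditions follow from [cfg] by arithmetic on positions; only
    the three connections are left to the caller. *)
Ltac find_theta x y A B C :=
  apply: (@theta_of_links _ e e_sym e_irr x y A B C no_theta);
  [ ne_tac | first [ assumption | adj_tac ] | sep_tac | sep_tac | sep_tac | | | ].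

Ltac meets_tac :=
  repeat first [ apply: meetsUl | apply: meetsUr ];
  (apply: meets_seg => ? ? ? ?; split; [ ne_tac | idtac ];
   let E := fresh "E" in let E' := fresh "E" in
   move=> E; have E' := E; rewrite e_sym in E';
   first [ fact E; local_facts E | fact E'; local_facts E' ];
   intros;
   repeat match goal with H : _ \/ _ |- _ => destruct H end;
   first [ exfalso; nat_lia
         | left; split; (congr (_ _); nat_lia)
         | right; split; (congr (_ _); nat_lia) ]).

Ltac find_prism a1 a2 a3 b1 b2 b3 A B C :=
  apply: (@prism_of_links _ e e_sym e_irr a1 a2 a3 b1 b2 b3 A B C no_prism);
  [ split; edge_tac | split; edge_tac | split; ne_tac
  | meets_tac | meets_tac | meets_tac | split; mem_end | | | ].

(** The triangles [ps c, Y n, Y n.+1] and [b_r, b_s, b_t] span a prism: one path goes through the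
    apex and along [P_r], the other two are arcs of [Y]. *)
Lemma contact_pair_s c n :
  0 < c <= cs -> 0 < n -> n.+1 < N -> e (Y n) (ps c) -> e (Y n.+1) (ps c) ->
  (forall d i, d <= c -> i <= N -> e (Y i) (ps d) -> d = c /\ n <= i <= n.+1) ->
  (forall d i, 0 < d <= cr -> i <= N -> e (Y i) (pr d) -> d = cr /\ (i = 0 \/ i = N)) ->
  False.
Proof.
move=> c_le n_gt n_lt en en1 only_n r_end; bounds.
find_prism (ps c) (Y n) (Y n.+1) (pr cr) (Y 0) (Y N)
  (seg ps 0 c :|: seg pr 1 cr) (seg Y 0 n) (seg Y n.+1 N).
- by run ps c 0; step (pr 1); run pr 1 cr; stop.
- by run Y n 0; stop.
- by run Y n.+1 N; stop.
Qed.

Lemma contact_pair_t c n :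
  0 < c <= ct -> 0 < n -> n.+1 < N -> e (Y n) (pt c) -> e (Y n.+1) (pt c) ->
  (forall d i, d <= c -> i <= N -> e (Y i) (pt d) -> d = c /\ n <= i <= n.+1) ->
  (forall d i, 0 < d <= cr -> i <= N -> e (Y i) (pr d) -> d = cr /\ (i = 0 \/ i = N)) ->
  False.
Proof.
move=> c_le n_gt n_lt en en1 only_n r_end; bounds.
find_prism (pt c) (Y n) (Y n.+1) (pr cr) (Y 0) (Y N)
  (seg pt 1 c :|: (seg ps 0 0 :|: seg pr 1 cr)) (seg Y 0 n) (seg Y n.+1 N).
- by run pt c 1; step (ps 0); step (pr 1); run pr 1 cr; stop.
- by run Y n 0; stop.
- by run Y n.+1 N; stop.
Qed.

(** A single first contact [Y n] and the apex are the ends of a theta, unless [Y n] lies strictly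
    between the outermost contacts of the other leg; in that case [a_t] replaces the apex. *)
Lemma single_contact_s c n c' n1 n2 :
  0 < c <= cs -> 0 < n < N -> e (Y n) (ps c) ->
  (forall d i, d <= c -> i <= N -> e (Y i) (ps d) -> d = c /\ n <= i <= n) ->
  0 < c' <= ct -> e (Y n1) (pt c') -> e (Y n2) (pt c') -> n1 <= n2 <= N ->
  (forall d i, d <= c' -> i <= N -> e (Y i) (pt d) -> d = c' /\ n1 <= i <= n2) ->
  (forall d i, 0 < d <= cr -> i <= N -> e (Y i) (pr d) -> d = cr /\ (i = 0 \/ i = N)) ->
  False.
Proof.
move=> c_le n_lt ec only_n c'_le ec1 ec2 le_n12 only_n' r_end; bounds.
have [n1_gt n2_lt far] : [/\ 0 < n1, n2 < N & n1.+2 <= n2 -> c' = 1 /\ k < n1].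
  have := adYt (i := n1) (d := c') ltac:(lia) ltac:(lia) ec1.
  by have := adYt (i := n2) (d := c') ltac:(lia) ltac:(lia) ec2; split; lia.
(* The leg along [P_t] reaches [Y n] from one side, and [P_r] with the base reaches it from the
   other. *)
have [le_n|lt_n1] := leqP n n1.
  find_theta (ps 0) (Y n) (seg ps 1 c) (seg pt 1 c' :|: seg Y n.+1 n1)
    (seg pr 1 cr :|: seg Y 0 n.-1).
  - by step (ps 1); run ps 1 c; step (Y n); stop.
  - by step (pt 1); run pt 1 c'; step (Y n1); run Y n1 n; stop.
  - by step (pr 1); run pr 1 cr; step (Y 0); run Y 0 n; stop.
have [le_n|lt_n2] := leqP n2 n.
  find_theta (ps 0) (Y n) (seg ps 1 c) (seg pt 1 c' :|: seg Y n2 n.-1)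
    (seg pr 1 cr :|: seg Y n.+1 N).
  - by step (ps 1); run ps 1 c; step (Y n); stop.
  - by step (pt 1); run pt 1 c'; step (Y n2); run Y n2 n; stop.
  - by step (pr 1); run pr 1 cr; step (Y N); run Y N n; stop.
have {far} [c'1 far] := far ltac:(lia); subst c'.
(* For [c = 1] there would be a C4 on [Y n], [a_s], [a], [a_t]; for [1 < c] the index [n] is [k] or
   [k.+1], while here [k < n1 < n]. *)
have nadj : ~ e (pt 1) (Y n).
  rewrite e_sym => et; have c1 : c <> 1.
    by move=> c1; apply: (cf_sq_st cfg (i := n)) => //; [lia | rewrite -c1].
  by have := adYs (i := n) (d := c) ltac:(lia) ltac:(lia) ec; lia.
find_theta (pt 1) (Y n) (seg ps 0 c) (seg Y n1 n.-1) (seg Y n.+1 n2).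
- by step (ps 0); run ps 0 c; step (Y n); stop.
- by step (Y n1); run Y n1 n; stop.
- by step (Y n2); run Y n2 n; stop.
Qed.

(** Mirror image of [single_contact_s]; the bound [n < n2 <= l] now excludes the deep contacts. *)
Lemma single_contact_t c n c' n1 n2 :
  0 < c <= ct -> 0 < n < N -> e (Y n) (pt c) ->
  (forall d i, d <= c -> i <= N -> e (Y i) (pt d) -> d = c /\ n <= i <= n) ->
  0 < c' <= cs -> e (Y n1) (ps c') -> e (Y n2) (ps c') -> n1 <= n2 <= N ->
  (forall d i, d <= c' -> i <= N -> e (Y i) (ps d) -> d = c' /\ n1 <= i <= n2) ->
  (forall d i, 0 < d <= cr -> i <= N -> e (Y i) (pr d) -> d = cr /\ (i = 0 \/ i = N)) ->
  False.
Proof.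
move=> c_le n_lt ec only_n c'_le ec1 ec2 le_n12 only_n' r_end; bounds.
have [n1_gt n2_lt far] : [/\ 0 < n1, n2 < N & n1.+2 <= n2 -> c' = 1 /\ n2 <= l].
  have := adYs (i := n1) (d := c') ltac:(lia) ltac:(lia) ec1.
  by have := adYs (i := n2) (d := c') ltac:(lia) ltac:(lia) ec2; split; lia.
have [le_n|lt_n1] := leqP n n1.
  find_theta (ps 0) (Y n) (seg pt 1 c) (seg ps 1 c' :|: seg Y n.+1 n1)
    (seg pr 1 cr :|: seg Y 0 n.-1).
  - by step (pt 1); run pt 1 c; step (Y n); stop.
  - by step (ps 1); run ps 1 c'; step (Y n1); run Y n1 n; stop.
  - by step (pr 1); run pr 1 cr; step (Y 0); run Y 0 n; stop.
have [le_n|lt_n2] := leqP n2 n.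
  find_theta (ps 0) (Y n) (seg pt 1 c) (seg ps 1 c' :|: seg Y n2 n.-1)
    (seg pr 1 cr :|: seg Y n.+1 N).
  - by step (pt 1); run pt 1 c; step (Y n); stop.
  - by step (ps 1); run ps 1 c'; step (Y n2); run Y n2 n; stop.
  - by step (pr 1); run pr 1 cr; step (Y N); run Y N n; stop.
have {far} [c'1 far] := far ltac:(lia); subst c'.
have nadj : ~ e (ps 1) (Y n).
  rewrite e_sym => es; have c1 : c <> 1.
    by move=> c1; apply: (cf_sq_st cfg (i := n)) => //; [lia | rewrite -c1].
  by have := adYt (i := n) (d := c) ltac:(lia) ltac:(lia) ec; lia.
find_theta (ps 1) (Y n) (seg ps 0 0 :|: seg pt 1 c) (seg Y n1 n.-1) (seg Y n.+1 n2).
- by step (ps 0); step (pt 1); run pt 1 c; step (Y n); stop.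
- by step (Y n1); run Y n1 n; stop.
- by step (Y n2); run Y n2 n; stop.
Qed.

(* The hubs [p 1], [q 1] are joined through the apex, by the arc of [Y] through
   the base edge and by an arc between their inner contacts; these arcs are
   apart unless a hub has only one contact at its end of the order, which gives
   a theta at the apex. *)
Ltac crossing p q n1 n2 m1 m2 :=
  have [?|?] := leqP n2 m1;
  [ find_theta (p 1) (q 1) (seg ps 0 0) (seg Y n2 m1) (seg Y 0 n1 :|: seg Y m2 N);
    [ step (ps 0); step (q 1); stop
    | step (Y n2); run Y n2 m1; step (q 1); stop
    | step (Y n1); run Y n1 0; step (Y N); run Y N m2; step (q 1); stop ]
  | have [?|?] := eqVneq m1 n1.+1;
    [ find_theta (ps 0) (Y n1) (seg p 1 1) (seg q 1 1 :|: seg Y m1 m1)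
        (seg pr 1 cr :|: seg Y 0 n1.-1);
      [ step (p 1); step (Y n1); stop
      | step (q 1); step (Y m1); step (Y n1); stop
      | step (pr 1); run pr 1 cr; step (Y 0); run Y 0 n1; stop ]
    | have [?|?] := eqVneq m2 n2.+1;
      [ find_theta (ps 0) (Y m2) (seg q 1 1) (seg p 1 1 :|: seg Y n2 n2)
          (seg pr 1 cr :|: seg Y m2.+1 N);
        [ step (q 1); step (Y m2); stop
        | step (p 1); step (Y n2); step (Y m2); stop
        | step (pr 1); run pr 1 cr; step (Y N); run Y N m2; stop ]
      | find_theta (p 1) (q 1) (seg ps 0 0) (seg Y m1 n2) (seg Y 0 n1 :|: seg Y m2 N);
        [ step (ps 0); step (q 1); stop
        | step (Y n2); run Y n2 m1; step (q 1); stop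
        | step (Y n1); run Y n1 0; step (Y N); run Y N m2; step (q 1); stop ] ] ] ].

Ltac nested p q n1 n2 m1 m2 :=
  find_theta (p 1) (q 1) (seg ps 0 0) (seg Y n1 m1) (seg Y m2 n2);
  [ step (ps 0); step (q 1); stop
  | step (Y n1); run Y n1 m1; step (q 1); stop
  | step (Y n2); run Y n2 m2; step (q 1); stop ].

(** The contact intervals of [a_s] and [a_t] are either nested or follow one another, possibly
    overlapping. Nested intervals leave two arcs of [Y] joining the hubs, and the apex gives the
    third path. *)
Lemma two_hubs n1 n2 m1 m2 :
  e (Y n1) (ps 1) -> e (Y n2) (ps 1) -> e (Y m1) (pt 1) -> e (Y m2) (pt 1) ->
  0 < n1 -> n1.+1 < n2 -> n2 < N -> 0 < m1 -> m1.+1 < m2 -> m2 < N ->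
  (forall d i, d <= 1 -> i <= N -> e (Y i) (ps d) -> d = 1 /\ n1 <= i <= n2) ->
  (forall d i, d <= 1 -> i <= N -> e (Y i) (pt d) -> d = 1 /\ m1 <= i <= m2) ->
  (forall d i, 0 < d <= cr -> i <= N -> e (Y i) (pr d) -> d = cr /\ (i = 0 \/ i = N)) ->
  False.
Proof.
move=> en1 en2 em1 em2 n1_gt n12 n2_lt m1_gt m12 m2_lt only_n only_m r_end; bounds.
(* A common contact of both hubs would close a C4 through the apex. *)
have no_s d i : d <= 1 -> i <= N -> e (Y i) (ps d) -> i <> m1 /\ i <> m2.
  move=> le_d le_i es; have [d1 _] := only_n _ _ le_d le_i es; rewrite d1 in es.
  by split=> iE; apply: (cf_sq_st cfg le_i es); rewrite iE.
have no_t d i : d <= 1 -> i <= N -> e (Y i) (pt d) -> i <> n1 /\ i <> n2.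
  move=> le_d le_i et; have [d1 _] := only_m _ _ le_d le_i et; rewrite d1 in et.
  by split=> iE; apply: (cf_sq_st cfg le_i _ et); rewrite iE.
have [ne1 _] := no_s 1 n1 isT ltac:(lia) en1.
have [_ ne2] := no_s 1 n2 isT ltac:(lia) en2.
have [lt1|lt1] := leqP n1 m1; have [lt2|lt2] := leqP n2 m2.
- by crossing ps pt n1 n2 m1 m2.
- by nested ps pt n1 n2 m1 m2.
- by nested pt ps m1 m2 n1 n2.
by crossing pt ps m1 m2 n1 n2.
Qed.

(** Each of the two legs first meets [Y] in one vertex, in a consecutive pair, or in contacts
    further apart. The last case happens only at [a_s] or [a_t], since deeper vertices see at most
    two consecutive vertices of [Y]. *)
Lemma no_inner_contact_false :
  (forall d i, 0 < d <= cr -> i <= N -> e (Y i) (pr d) -> d = cr /\ (i = 0 \/ i = N)) ->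
  False.
Proof.
move=> r_end; bounds.
have [c [n1 [n2 [c_le en1 en2 le_n only_n]]]] := @first_contact
  (fun d i => e (Y i) (ps d)) cs N cs k ltac:(lia) ltac:(lia) (cf_Ys_end cfg).
have [f [m1 [m2 [f_le em1 em2 le_m only_m]]]] := @first_contact
  (fun d i => e (Y i) (pt d)) ct N ct l.+1 ltac:(lia) ltac:(lia) (cf_Yt_end cfg).
have [c_gt n1_gt n2_lt farn] : [/\ 0 < c, 0 < n1, n2 < N & n1.+1 < n2 -> c = 1].
  have := adYs (i := n1) (d := c) ltac:(lia) ltac:(lia) en1.
  by have := adYs (i := n2) (d := c) ltac:(lia) ltac:(lia) en2; split; lia.
have [f_gt m1_gt m2_lt farm] : [/\ 0 < f, 0 < m1, m2 < N & m1.+1 < m2 -> f = 1].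
  have := adYt (i := m1) (d := f) ltac:(lia) ltac:(lia) em1.
  by have := adYt (i := m2) (d := f) ltac:(lia) ltac:(lia) em2; split; lia.
have [nE|n12] := eqVneq n2 n1.
  by subst n2; apply: (@single_contact_s c n1 f m1 m2) => //; lia.
have [mE|m12] := eqVneq m2 m1.
  by subst m2; apply: (@single_contact_t f m1 c n1 n2) => //; lia.
have [nE|n12'] := eqVneq n2 n1.+1.
  by subst n2; apply: (@contact_pair_s c n1) => //; lia.
have [mE|m12'] := eqVneq m2 m1.+1.
  by subst m2; apply: (@contact_pair_t f m1) => //; lia.
have c1 := farn ltac:(lia); have f1 := farm ltac:(lia); subst c f.
by apply: (@two_hubs n1 n2 m1 m2) => //; lia.
Qed.

(** The resulting triangle [ps c, Y n, Y n.+1] is one end of a prism whose other end comes from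
    [P_t]. Every other pattern of contacts gives a theta or a prism at once. *)
Lemma inner_contact_s rho1 rho2 :
  k < rho1 -> rho1 <= rho2 <= l -> e (Y rho1) (pr 1) -> e (Y rho2) (pr 1) ->
  (forall d i, d = 1 -> i <= N -> e (Y i) (pr d) -> rho1 <= i <= rho2) ->
  exists c n, [/\ 0 < c <= cs, n < rho1, e (Y n) (ps c), e (Y n.+1) (ps c) &
    forall d i, d <= c -> i <= N -> e (Y i) (ps d) -> d = c /\ n <= i <= n.+1].
Proof.
move=> k_lt le_rho er1 er2 only_r; bounds.
have cr_gt : 1 < cr.
  by have := adYr (i := rho1) (d := 1) ltac:(nat_lia) ltac:(nat_lia) er1; nat_lia.
(* Contacts are searched only up to [rho1]; those beyond are excluded later. *)
have [c [n1 [n2 [c_le en1 en2 le_n first_s]]]] := @first_contact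
  (fun d i => e (Y i) (ps d)) cs rho1 cs k ltac:(nat_lia) ltac:(nat_lia) (cf_Ys_end cfg).
have [c_gt n1_gt farn near1] :
    [/\ 0 < c, 0 < n1, n1.+1 < n2 -> c = 1 & 1 < c -> k <= n1 /\ n2 <= k.+1].
  have := adYs (i := n1) (d := c) ltac:(nat_lia) ltac:(nat_lia) en1.
  by have := adYs (i := n2) (d := c) ltac:(nat_lia) ltac:(nat_lia) en2; split; nat_lia.
have c1_ne i : i <= N -> e (Y i) (pr 1) -> e (Y i) (ps c) -> 1 < c.
  move=> le_i er es; have [cE|] := eqVneq c 1; last by nat_lia.
  by rewrite cE in es; case: (cf_sq_sr cfg le_i es er).
have [n2E|n12] : n2 = n1.+1 \/ n2 <> n1.+1 by nat_lia.
  subst n2.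
  (* Beyond [rho1 > k] only [a_s] could have a contact, as deeper vertices see only [Y k] and
     [Y k.+1]. *)
  suff far_s i : rho1 < i -> i <= N -> ~ e (Y i) (ps 1).
    exists c, n1; split=> //; [by nat_lia | by nat_lia |].
    move=> d i le_d le_i es; have [le_r|lt_r] := leqP i rho1; first exact: first_s.
    have [dE|ne_d] := eqVneq d 1; first by rewrite dE in es; case: (far_s i).
    by have := adYs (i := i) (d := d) ltac:(nat_lia) ltac:(nat_lia) es; nat_lia.
  move=> lt_i le_i es.
  have le_il : i <= l by have := adYs (i := i) (d := 1) ltac:(nat_lia) ltac:(nat_lia) es; nat_lia.
  have beyond d j : d <= c -> j <= N -> e (Y j) (ps d) -> 1 < d -> d = c /\ n1 <= j <= n1.+1.
    move=> le_d le_j ej d_gt; apply: first_s => //.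
    by have := adYs (i := j) (d := d) ltac:(nat_lia) ltac:(nat_lia) ej; nat_lia.
  (* A pair below [rho1] keeps [Y 0 .. Y n1] apart from the arc between [Y rho1] and [Y i], giving a
     theta between [a_r] and [a_s]. Otherwise [Y rho1] is in the pair, and the absence of C4 forces
     [1 < c] and [n1 = k]. *)
  have [lt_n|n1E] : n1.+1 < rho1 \/ n1.+1 = rho1 by nat_lia.
    find_theta (pr 1) (ps 1) (seg ps 0 0) (seg Y rho1 i)
      (seg pr 2 cr :|: (seg Y 0 n1 :|: seg ps 2 c)).
    - by step (ps 0); step (ps 1); stop.
    - by step (Y rho1); run Y rho1 i; step (ps 1); stop.
    - by step (pr 2); run pr 2 cr; step (Y 0); run Y 0 n1; step (ps c); run ps c 1; stop.
  have c_gt1 : 1 < c by apply: (c1_ne rho1) => //; [nat_lia | rewrite -n1E].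
  have n1k : n1 = k by lia.
  subst n1 rho1.
  have [s1 [s2 [es1 es2 le_s s2_le only_s]]] :=
    @extremes (fun j => e (Y j) (ps 1)) N i le_i es.
  have s1_gt : k.+1 < s1.
    rewrite ltnNge; apply/negP => le_s1.
    by have [] := first_s 1 s1 ltac:(nat_lia) ltac:(nat_lia) es1; nat_lia.
  have s2_lt : s2 <= l by have := adYs (i := s2) (d := 1) ltac:(nat_lia) ltac:(nat_lia) es2; nat_lia.
  have either d j : d <= c -> j <= N -> e (Y j) (ps d) ->
      (d = 1 /\ s1 <= j <= s2) \/ (d = c /\ k <= j <= k.+1).
    move=> le_d le_j ej; have [d1|ne_d] := eqVneq d 1.
      by left; rewrite d1 in ej; split=> //; apply: only_s.
    right; apply: beyond => //.
    by have := adYs (i := j) (d := d) ltac:(nat_lia) ltac:(nat_lia) ej; nat_lia.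
  clear only_s.
  (* A second contact of [a_r] restores the gap for the same theta. If [Y k.+1] is its only contact,
     the outermost contacts [s1], [s2] of [a_s] decide: a consecutive pair gives a prism, anything
     else a theta. *)
  have [lt_r|rE] : k.+1 < rho2 \/ rho2 = k.+1 by nat_lia.
    find_theta (pr 1) (ps 1) (seg ps 0 0) (seg Y (minn rho2 i) (maxn rho2 i))
      (seg pr 2 cr :|: (seg Y 0 k :|: seg ps 2 c)).
    - by step (ps 0); step (ps 1); stop.
    - by step (Y rho2); run Y rho2 i; step (ps 1); stop.
    - by step (pr 2); run pr 2 cr; step (Y 0); run Y 0 k; step (ps c); run ps c 1; stop.
  subst rho2.
  have [s2E|[s2E|lt_s]] : s2 = s1 \/ s2 = s1.+1 \/ s1.+1 < s2 by nat_lia.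
  - subst s2; find_theta (pr 1) (Y s1) (seg ps 0 1) (seg Y k.+1 s1.-1)
      (seg pr 2 cr :|: seg Y s1.+1 N).
    + by step (ps 0); step (ps 1); step (Y s1); stop.
    + by step (Y k.+1); run Y k.+1 s1; stop.
    + by step (pr 2); run pr 2 cr; step (Y N); run Y N s1; stop.
  - subst s2; find_prism (ps 1) (Y s1) (Y s1.+1) (ps c) (Y k.+1) (Y k)
      (seg ps 1 c) (seg Y k.+1 s1) (seg Y s1.+1 N :|: seg Y 0 k).
    + by run ps 1 c; stop.
    + by run Y s1 k.+1; stop.
    + by run Y s1.+1 N; step (Y 0); run Y 0 k; stop.
  find_theta (pr 1) (ps 1) (seg ps 0 0) (seg Y k.+1 s1) (seg pr 2 cr :|: seg Y s2 N).
  - by step (ps 0); step (ps 1); stop.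
  - by step (Y k.+1); run Y k.+1 s1; step (ps 1); stop.
  - by step (pr 2); run pr 2 cr; step (Y N); run Y N s2; step (ps 1); stop.
have [n2E|far] : n2 = n1 \/ n1.+1 < n2 by nat_lia.
  subst n2; exfalso; have [lt_n|n1E] : n1 < rho1 \/ n1 = rho1 by nat_lia.
    find_theta (pr 1) (Y n1) (seg ps 0 c) (seg Y n1.+1 rho1) (seg pr 2 cr :|: seg Y 0 n1.-1).
    - by step (ps 0); run ps 0 c; step (Y n1); stop.
    - by step (Y rho1); run Y rho1 n1; stop.
    - by step (pr 2); run pr 2 cr; step (Y 0); run Y 0 n1; stop.
  (* Now [Y n1] is the first vertex of X, seen by both the leg and [a_r]; the third path from the
     apex goes around through [P_t] and the base edge. *)
  have c_gt1 : 1 < c by apply: (c1_ne n1) => //; [nat_lia | rewrite n1E].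
  have n1k : n1 = k.+1 by lia.
  have ern : e (Y n1) (pr 1) by rewrite n1E.
  find_theta (ps 0) (Y n1) (seg ps 1 c) (seg pr 1 1)
    (seg pt 1 ct :|: (seg Y l.+1 N :|: seg Y 0 k)).
  - by step (ps 1); run ps 1 c; step (Y n1); stop.
  - by step (pr 1); step (Y n1); stop.
  - by step (pt 1); run pt 1 ct; step (Y l.+1); run Y l.+1 N; step (Y 0); run Y 0 k;
      step (Y n1); stop.
exfalso; have c1 := farn far; subst c.
find_theta (pr 1) (ps 1) (seg ps 0 0) (seg Y n2 rho1) (seg Y 0 n1 :|: seg pr 2 cr).
- by step (ps 0); step (ps 1); stop.
- by step (Y rho1); run Y rho1 n2; step (ps 1); stop.
- by step (pr 2); run pr 2 cr; step (Y 0); run Y 0 n1; step (ps 1); stop.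
Qed.

(** The two contact pairs give the triangles of a prism, joined through the apex, by the arc between
    the pairs, and by the arc through the base edge. *)
Lemma inner_contact_false rho1 rho2 c' n' :
  k < rho1 -> rho1 <= rho2 <= l -> e (Y rho1) (pr 1) -> e (Y rho2) (pr 1) ->
  (forall d i, d = 1 -> i <= N -> e (Y i) (pr d) -> rho1 <= i <= rho2) ->
  0 < c' <= ct -> rho2 <= n' < N -> e (Y n') (pt c') -> e (Y n'.+1) (pt c') ->
  (forall d i, d <= c' -> i <= N -> e (Y i) (pt d) -> d = c' /\ n' <= i <= n'.+1) ->
  False.
Proof.
move=> k_lt le_rho er1 er2 only_r c'_le n'_le et et1 only_t; bounds.
have [c [n [c_le n_lt es es1 only_s]]] := inner_contact_s k_lt le_rho er1 er2 only_r.
have n_gt : 0 < n by have := adYs (i := n) (d := c) ltac:(lia) ltac:(lia) es; lia.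
have n'_lt : n'.+1 < N.
  by have := adYt (i := n'.+1) (d := c') ltac:(lia) ltac:(lia) et1; lia.
have cr_gt : 1 < cr.
  by have := adYr (i := rho1) (d := 1) ltac:(lia) ltac:(lia) er1; lia.
(* If X is a single vertex, it is the end of a theta with the apex. *)
have [lE|l_gt] : l = k.+1 \/ k.+1 < l by lia.
  have erl : e (Y l) (pr 1) by rewrite (_ : l = rho1) //; lia.
  have ek : e (Y k) (Y l) by apply: eYY; lia.
  find_theta (ps 0) (Y l) (seg ps 1 cs :|: seg Y k k) (seg pt 1 ct :|: seg Y l.+1 l.+1)
    (seg pr 1 1).
  - by step (ps 1); run ps 1 cs; step (Y k); step (Y l); stop.
  - by step (pt 1); run pt 1 ct; step (Y l.+1); step (Y l); stop.
  - by step (pr 1); step (Y l); stop.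
(* Pairs overlapping in [Y rho1] would, without C4, have [c] and [c'] above 1, so that
   [l <= rho1 <= k.+1]. *)
have n_lt' : n.+1 < n'.
  rewrite ltnNge; apply/negP => le_n'.
  have [nE n'E] : n.+1 = rho1 /\ n' = rho1 by lia.
  have c_ne : c <> 1.
    move=> cE; rewrite cE nE in es1.
    by apply: (cf_sq_sr cfg _ es1 er1); lia.
  have c'_ne : c' <> 1.
    move=> cE; rewrite cE n'E in et.
    by apply: (cf_sq_tr cfg _ et er1); lia.
  have := adYs (i := n.+1) (d := c) ltac:(lia) ltac:(lia) es1.
  by have := adYt (i := n') (d := c') ltac:(lia) ltac:(lia) et; lia.
find_prism (ps c) (Y n.+1) (Y n) (pt c') (Y n') (Y n'.+1)
  (seg ps 0 c :|: seg pt 1 c') (seg Y n.+1 n') (seg Y 0 n :|: seg Y n'.+1 N).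
- by run ps c 0; step (pt 1); run pt 1 c'; stop.
- by run Y n.+1 n'; stop.
- by run Y n 0; step (Y N); run Y N n'.+1; stop.
Qed.

End LegConfig.

Lemma leg_config_false (T : finType) (e : rel T) (e_sym : symmetric e)
    (e_irr : irreflexive e) (no_theta : forall x y P, ~ theta e x y P)
    (no_prism : forall x y P, ~ prism e x y P) Y N k l ps cs pt ct pr cr :
  leg_config e Y N k l ps cs pt ct pr cr -> False.
Proof.
move=> cfg; have [k_gt k_lt l_lt] := cf_k cfg; have [cs_gt ct_gt cr_gt] := cf_c cfg.
have [[i /and3P[i_gt i_le er]]|no_r] :
    (exists i, [&& k < i, i <= l & e (Y i) (pr 1)]) \/
    (forall i, k < i -> i <= l -> ~ e (Y i) (pr 1)).
  have [/hasP[i]|/hasPn no] := boolP (has (fun i => e (Y i) (pr 1)) (iota k.+1 (l - k))).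
    by rewrite mem_iota => i_in er; left; exists i; rewrite er; lia.
  right=> i i_gt i_le er; have /no/negP[] // : i \in iota k.+1 (l - k).
  by rewrite mem_iota; lia.
- have le_iN : i <= N by lia.
  have [rho1 [rho2 [er1 er2 le_i rho2_le only_r]]] :=
    extremes (p := fun i => e (Y i) (pr 1)) le_iN er.
  have r_in j : j <= N -> e (Y j) (pr 1) -> k < j <= l.
    move=> le_j ej; have := adYr cfg le_iN (d := 1) ltac:(lia) er.
    by have := adYr cfg le_j (d := 1) ltac:(lia) ej; lia.
  have b1 := r_in rho1 ltac:(lia) er1; have b2 := r_in rho2 ltac:(lia) er2.
  have only_r' d j : d = 1 -> j <= N -> e (Y j) (pr d) -> rho1 <= j <= rho2.
    by move=> ->; apply: only_r.
  (* Reversal yields the pair for [P_t]: positions [n'], [n'.+1] of the reversed hole are [N - n'],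
     [N - n'.+1] on [Y]. *)
  have cfg' := leg_config_rev e_sym cfg.
  have [|||||c' [n' [c'_le n'_lt et et1 only_t]]] := @inner_contact_s _ _ e_sym e_irr
    no_theta no_prism _ _ _ _ _ _ _ _ _ _ cfg' (N - rho2) (N - rho1).
  + by lia.
  + by lia.
  + by rewrite subKn //; lia.
  + by rewrite subKn //; lia.
  + move=> d j dE le_j ej; have := only_r' d (N - j) dE (leq_subr _ _) ej; lia.
  have n'E : N - n' = (N - n'.+1).+1 by lia.
  apply: (@inner_contact_false _ _ e_sym e_irr no_theta no_prism _ _ _ _ _ _ _ _ _ _
    cfg rho1 rho2 c' (N - n'.+1)) => //.
  + by lia.
  + by lia.
  + by lia.
  + by rewrite -n'E.
  move=> d j le_d le_j ej; have [] := only_t d (N - j) le_d (leq_subr _ _).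
    by rewrite subKn.
  by lia.
apply: (no_inner_contact_false e_sym e_irr no_theta no_prism cfg) => d i d_in i_le er.
have [//|[dE [d_lt /andP[i_gt i_le']]]] := adYr cfg i_le d_in er.
rewrite dE in er.
by case: (no_r i).
Qed.

(** * The minimal path *)

Section PyramidIndices.

Variables (T : finType) (e : rel T).
Hypotheses (e_sym : symmetric e) (e_irr : irreflexive e).
Hypotheses (no_C4 : forall c, hole e c -> size c <> 4)
  (no_theta : forall x y P, ~ theta e x y P)
  (no_prism : forall x y P, ~ prism e x y P).
(** [p h d] is the vertex of [P_h] at distance [d] from the apex along the path, so [p h 1] is [a_h]
    and [p h (L h)] is [b_h]; below, [g 0 .. g M] is the interior of [P]. *)
Variables (a : T) (p : 'I_3 -> nat -> T) (L : 'I_3 -> nat).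
Hypotheses (L_gt : forall h, 0 < L h) (p0 : forall h, p h 0 = a).
Hypothesis p_inj : forall h d f, d <= L h -> f <= L h -> p h d = p h f -> d = f.
Hypothesis p_adj : forall h d f, d <= L h -> f <= L h ->
  e (p h d) (p h f) = (f == d.+1) || (d == f.+1).
Hypothesis p_cross : forall (h h' : 'I_3) d f, h != h' -> 0 < d <= L h -> 0 < f <= L h' ->
  p h d <> p h' f /\ (e (p h d) (p h' f) -> d = L h /\ f = L h').
Hypothesis base_adj : forall h h' : 'I_3, h != h' -> e (p h (L h)) (p h' (L h')).
Variables (g : nat -> T) (M : nat).
Hypothesis g_inj : forall i j, i <= M -> j <= M -> g i = g j -> i = j.
Hypothesis g_adj : forall i j, i <= M -> j <= M ->
  e (g i) (g j) = (j == i.+1) || (i == j.+1).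
Hypothesis g_apex : forall z, z <= M -> g z <> a /\ ~ e (g z) a.
Hypothesis g_base : forall z h, z <= M -> g z <> p h (L h) /\ ~ e (g z) (p h (L h)).

Ltac nat_lia :=
  repeat match goal with
  | H : is_true (e _ _) |- _ => clear H
  | H : @eq T _ _ |- _ => clear H
  | H : @eq 'I_3 _ _ |- _ => clear H
  | H : ~ _ |- _ => clear H
  | H : forall _, _ |- _ => clear H
  | H : is_true (~~ @eq_op 'I_3 _ _) |- _ => clear H
  | H : is_true (has _ _) |- _ => clear H
  end; lia.

Lemma p_step h d : d < L h -> e (p h d) (p h d.+1).
Proof. by move=> lt_d; rewrite p_adj ?eqxx // ltnW. Qed.

(** Stopping one leg before the base rules out the base edge, so only an edge at the apex
    remains. *)
Lemma legs_apart (h h' : 'I_3) d f : h != h' -> d < L h -> 0 < f <= L h' ->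
  p h d <> p h' f /\ (e (p h d) (p h' f) -> d = 0 /\ f = 1).
Proof.
move=> ne_h d_lt f_le; have [->|d_gt] := posnP d.
  rewrite p0 -(p0 h'); split; first by move/p_inj; nat_lia.
  by rewrite p_adj; nat_lia.
have [ne adj] := p_cross ne_h (ltac:(nat_lia) : 0 < d <= L h) f_le.
by split=> // /adj; nat_lia.
Qed.

Lemma g_foot z h d : z <= M -> d <= L h -> e (g z) (p h d) -> 0 < d < L h.
Proof.
move=> le_z le_d adj; rewrite lt0n ltn_neqAle le_d andbT.
apply/andP; split; apply/eqP => dE; rewrite dE in adj.
  by rewrite p0 in adj; case: (g_apex le_z).
by case: (g_base h le_z).
Qed.

(** Following each leg from [a] to a neighbor of [g z] gives a theta between [a] and [g z]. *)
Lemma three_feet z (d : 'I_3 -> nat) (h1 h2 h3 : 'I_3) : z <= M ->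
  h1 != h2 -> h1 != h3 -> h2 != h3 ->
  (forall h, d h <= L h /\ e (g z) (p h (d h))) -> False.
Proof.
move=> le_z n12 n13 n23 feet.
have d_in h : 0 < d h < L h by have [le_d] := feet h; apply: g_foot.
have [ne nadj] := g_apex le_z.
have apart h h' : h != h' -> sep e (seg (p h) 1 (d h)) (seg (p h') 1 (d h')).
  move=> ne_h; apply: sep_seg => i j i_in j_in.
  have := d_in h; have := d_in h' => ? ?.
  have [ne_p adj_p] := legs_apart ne_h (ltac:(nat_lia) : i < L h) (ltac:(nat_lia) : 0 < j <= L h').
  by split=> // /adj_p; nat_lia.
have linked h : link e (a |: (g z |: seg (p h) 1 (d h))) a (g z).
  have d_h := d_in h; have [_ adj] := feet h.
  apply: (link_step (y := p h 1)); first exact: setU11.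
  - by apply/setUP; right; apply/setUP; right; apply: in_seg; nat_lia.
  - by rewrite -(p0 h); apply: p_step; nat_lia.
  apply: (@link_run _ e e_sym _ (p h) 1 (d h)).
  - by move=> f f_in; apply: p_step; nat_lia.
  - by move=> f f_in; apply/setUP; right; apply/setUP; right; apply: in_seg; nat_lia.
  apply: link_step (link_refl e _ (g z)).
  - by apply/setUP; right; apply/setUP; right; apply: in_seg; nat_lia.
  - by apply/setUP; right; apply: setU11.
  by rewrite e_sym.
apply: (@theta_of_links _ e e_sym e_irr a (g z) (seg (p h1) 1 (d h1))
  (seg (p h2) 1 (d h2)) (seg (p h3) 1 (d h3)) no_theta) => //.
- exact: nesym.
- by rewrite e_sym.
- exact: apart.
- exact: apart.
exact: apart.
Qed.

Lemma one_apex_neighbor z (h h' : 'I_3) : z <= M -> h != h' ->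
  e (g z) (p h 1) -> e (g z) (p h' 1) -> False.
Proof.
move=> le_z ne_h adj adj'; have [ne nadj] := g_apex le_z.
have L1 := g_foot le_z (L_gt h) adj; have L1' := g_foot le_z (L_gt h') adj'.
have [ne_p adj_p] := legs_apart ne_h (ltac:(nat_lia) : 1 < L h) (ltac:(nat_lia) : 0 < 1 <= L h').
apply: (@no_square _ e e_sym e_irr (g z) (p h 1) a (p h' 1)) => //.
- by move/adj_p; nat_lia.
- by rewrite e_sym -(p0 h); apply: p_step; nat_lia.
- by rewrite -(p0 h'); apply: p_step; nat_lia.
by rewrite e_sym.
Qed.

(** The indices 2 to [L h - 1] are those of [P_h] without [a], [a_h], [b_h]. *)
Definition touches z h := has (fun d => e (g z) (p h d)) (iota 2 (L h - 2)).

Lemma touchesP z h :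
  reflect (exists2 d, 1 < d < L h & e (g z) (p h d)) (touches z h).
Proof.
apply: (iffP hasP) => [[d]|[d d_in adj]].
  by rewrite mem_iota => d_in adj; exists d => //; nat_lia.
by exists d => //; rewrite mem_iota; nat_lia.
Qed.

Ltac touch_lia :=
  repeat match goal with H : is_true (touches _ _) |- _ => clear H end; nat_lia.

Section Minimal.

Variables (x y : nat) (s t r : 'I_3).
Hypotheses (le_xy : x <= y) (le_yM : y <= M).
Hypotheses (ne_st : s != t) (ne_sr : s != r) (ne_tr : t != r).
Hypotheses (x_s : touches x s) (y_t : touches y t).
Hypothesis minimal : forall z z' h h', x <= z -> z <= z' -> z' <= y ->
  z' - z < y - x -> touches z h -> touches z' h' -> h = h'.

(** If [g z] were on [P_h], it would touch [P_h] only, and its neighbors on [P] would touch [P_h]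
    too; by minimality [h] would be both [s] and [t], or an end of X could be dropped. *)
Lemma off_pyramid z h d : x <= z <= y -> d <= L h -> g z <> p h d.
Proof.
move=> z_in le_d gz; have le_z : z <= M by touch_lia.
have [ne nadj] := g_apex le_z; have [ne_b nadj_b] := g_base h le_z.
have d_gt : 1 < d.
  case: d gz le_d => [|[|//]] gz le_d; first by rewrite p0 in gz.
  by case: nadj; rewrite gz e_sym -(p0 h); apply: p_step.
have d_lt : d.+1 < L h.
  rewrite ltn_neqAle (_ : d < L h) ?andbT; last first.
    by rewrite ltn_neqAle le_d andbT; apply/eqP => dE; rewrite dE in gz.
  by apply/eqP => dE; case: nadj_b; rewrite gz -dE; apply: p_step; rewrite dE.
have z_h : touches z h.
  by apply/touchesP; exists d.+1; [touch_lia | rewrite gz; apply: p_step; touch_lia].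
have only_h h' : touches z h' -> h = h'.
  case/touchesP => f f_in; rewrite gz => adj; apply/eqP/negPn/negP => ne_h.
  by have [_ /(_ adj)] := legs_apart ne_h (ltac:(touch_lia) : d < L h) (ltac:(touch_lia) : 0 < f <= L h'); touch_lia.
have near z' : z' <= M -> (z' == z.+1) || (z == z'.+1) -> touches z' h.
  move=> le_z' near_z; apply/touchesP; exists d; first by touch_lia.
  by rewrite -gz g_adj //; touch_lia.
have hs : z < y -> h = s by move=> lt_z; apply/esym/(minimal _ _ _ _ x_s z_h); touch_lia.
have ht : x < z -> h = t by move=> lt_z; apply: (minimal _ _ _ _ z_h y_t); touch_lia.
case/eqP: ne_st; have [zx|x_lt] := eqVneq z x; have [zy|lt_y] := eqVneq z y.
- have z_s : touches z s by rewrite zx.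
  have z_t : touches z t by rewrite zy.
  by rewrite -(only_h _ z_s) (only_h _ z_t).
- have hsE : h = s by apply: hs; touch_lia.
  have z1_s : touches x.+1 s by rewrite -hsE; apply: near; touch_lia.
  by apply: (minimal _ _ _ _ z1_s y_t); touch_lia.
- have htE : h = t by apply: ht; touch_lia.
  have z1_t : touches y.-1 t by rewrite -htE; apply: near; touch_lia.
  by apply: (minimal _ _ _ _ x_s z1_t); touch_lia.
have hsE : h = s by apply: hs; touch_lia.
by rewrite -hsE; apply: ht; touch_lia.
Qed.

Lemma deep_foot_s z d : x <= z <= y -> 1 < d <= L s -> e (g z) (p s d) -> z = x.
Proof.
move=> z_in d_in adj; have /andP[_ d_lt] := g_foot (ltac:(touch_lia) : z <= M) (ltac:(touch_lia) : d <= L s) adj.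
have z_s : touches z s by apply/touchesP; exists d; first touch_lia.
have [//|ne_z] := eqVneq z x; case/eqP: ne_st.
by apply: (minimal _ _ _ _ z_s y_t); touch_lia.
Qed.

Lemma deep_foot_t z d : x <= z <= y -> 1 < d <= L t -> e (g z) (p t d) -> z = y.
Proof.
move=> z_in d_in adj; have /andP[_ d_lt] := g_foot (ltac:(touch_lia) : z <= M) (ltac:(touch_lia) : d <= L t) adj.
have z_t : touches z t by apply/touchesP; exists d; first touch_lia.
have [//|ne_z] := eqVneq z y; case/eqP: ne_st.
by apply: (minimal _ _ _ _ x_s z_t); touch_lia.
Qed.

(** A vertex of X touching [P_r] would end a shorter connection or, if X is a single vertex,
    contradict [three_feet]. *)
Lemma no_deep_foot_r z d : x <= z <= y -> 0 < d <= L r -> e (g z) (p r d) ->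
  d = 1 /\ 1 < L r.
Proof.
move=> z_in d_in adj; have /andP[_ d_lt] := g_foot (ltac:(touch_lia) : z <= M) (ltac:(touch_lia) : d <= L r) adj.
have [->|ne_d] := eqVneq d 1; first by split=> //; touch_lia.
have z_r : touches z r by apply/touchesP; exists d; first touch_lia.
have [xy|ne_xy] := eqVneq x y.
  have zx : z = x by touch_lia.
  have /touchesP[ds ds_in ads] := x_s; have /touchesP[dt dt_in adt] := y_t.
  case: (@three_feet z (fun h => if h == s then ds else if h == t then dt else d) s t r) => //.
    by touch_lia.
  move=> h; have [->|hs] := eqVneq h s; first by rewrite zx; split=> //; touch_lia.
  have [->|ht] := eqVneq h t; first by rewrite zx xy; split=> //; touch_lia.
  suff -> : h = r by split=> //; touch_lia.
  apply/val_inj; move: hs ht ne_st ne_sr ne_tr; rewrite -!val_eqE /=.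
  by case: (h) (s) (t) (r) => [i ?] [j ?] [m ?] [n ?] /=; lia.
have [zx|ne_zx] := eqVneq z x.
  by case/eqP: ne_sr; apply: (minimal _ _ _ _ x_s z_r); touch_lia.
by case/eqP: ne_tr; apply/esym/(minimal _ _ _ _ z_r y_t); touch_lia.
Qed.

Lemma minimal_false : False.
Proof.
(* Neighbors farthest from the apex are chosen, so that [Y] gets no chord between X and [P_s] or
   [P_t]. *)
have [ds [ds_in ads max_ds]] : exists ds, [/\ 1 < ds < L s, e (g x) (p s ds) &
    forall d, d <= L s -> e (g x) (p s d) -> d <= ds].
  have /touchesP[d d_in adj] := x_s.
  have [n1 [ds [_ ads le_d ds_le ext]]] :=
    @extremes (fun d => e (g x) (p s d)) (L s) d (ltac:(touch_lia)) adj.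
  have /andP[_ ds_lt] := g_foot (leq_trans le_xy le_yM) ds_le ads.
  exists ds; split=> //; first by touch_lia.
  by move=> f le_f adj_f; have /andP[_ ->] := ext f le_f adj_f.
have [dt [dt_in adt max_dt]] : exists dt, [/\ 1 < dt < L t, e (g y) (p t dt) &
    forall d, d <= L t -> e (g y) (p t d) -> d <= dt].
  have /touchesP[d d_in adj] := y_t.
  have [n1 [dt [_ adt le_d dt_le ext]]] :=
    @extremes (fun d => e (g y) (p t d)) (L t) d (ltac:(touch_lia)) adj.
  have /andP[_ dt_lt] := g_foot le_yM dt_le adt.
  exists dt; split=> //; first by touch_lia.
  by move=> f le_f adj_f; have /andP[_ ->] := ext f le_f adj_f.
(* Counting from [b_s] at 0, [p s ds] is at [k], X fills [k.+1] to [l], and [p t dt] is at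
   [l.+1]. *)
have [k kE] : exists k, k = L s - ds by eexists.
have [l lE] : exists l, l = k.+1 + (y - x) by eexists.
have [N NE] : exists N, N = l.+1 + (L t - dt) by eexists.
have le_kl : k < l by touch_lia.
pose Y i := if i <= k then p s (L s - i)
  else if i <= l then g (x + (i - k.+1)) else p t (dt + (i - l.+1)).
have Y_s i : i <= k -> Y i = p s (L s - i) by rewrite /Y => ->.
have Y_g i : k < i <= l -> Y i = g (x + (i - k.+1)).
  by case/andP=> lt_i le_i; rewrite /Y leqNgt lt_i le_i.
have Y_t i : l < i -> Y i = p t (dt + (i - l.+1)).
  by move=> lt_i; rewrite /Y leqNgt (ltn_trans le_kl lt_i) /= leqNgt lt_i.
clearbody Y.
have Y_cases i : i <= N -> [\/ i <= k /\ Y i = p s (L s - i),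
    k < i <= l /\ Y i = g (x + (i - k.+1)) |
    l < i <= N /\ Y i = p t (dt + (i - l.+1))].
  move=> le_i; have [?|?] := leqP i k; first by apply: Or31; rewrite Y_s.
  have [?|?] := leqP i l; first by apply: Or32; rewrite Y_g //; touch_lia.
  by apply: Or33; rewrite Y_t //; touch_lia.
have Lr := L_gt r.
have g_in i : k < i <= l -> x <= x + (i - k.+1) <= y by touch_lia.
have g_M i : k < i <= l -> x + (i - k.+1) <= M by touch_lia.
have g_off i h d : k < i <= l -> d <= L h -> g (x + (i - k.+1)) <> p h d.
  by move=> i_in; apply: off_pyramid; touch_lia.
have g_s i d : k < i <= l -> d <= L s -> e (g (x + (i - k.+1))) (p s d) ->
    0 < d /\ (1 < d -> i = k.+1 /\ d <= ds).
  move=> i_in le_d adj; have /andP[d_gt _] := g_foot (g_M _ i_in) le_d adj.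
  split=> // d_gt1; have zx := deep_foot_s (g_in _ i_in) (ltac:(touch_lia) : 1 < d <= L s) adj.
  by rewrite zx in adj; have := max_ds _ le_d adj; touch_lia.
have g_t i d : k < i <= l -> d <= L t -> e (g (x + (i - k.+1))) (p t d) ->
    0 < d /\ (1 < d -> i = l /\ d <= dt).
  move=> i_in le_d adj; have /andP[d_gt _] := g_foot (g_M _ i_in) le_d adj.
  split=> // d_gt1; have zy := deep_foot_t (g_in _ i_in) (ltac:(touch_lia) : 1 < d <= L t) adj.
  by rewrite zy in adj; have := max_dt _ le_d adj; touch_lia.
have g_r i d : k < i <= l -> 0 < d <= L r -> e (g (x + (i - k.+1))) (p r d) ->
    d = 1 /\ 1 < L r.
  by move=> i_in; apply: no_deep_foot_r; touch_lia.
have st := legs_apart ne_st; have sr := legs_apart ne_sr; have tr := legs_apart ne_tr.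
have ts := legs_apart (ltac:(by rewrite eq_sym) : t != s).
have cst := p_cross ne_st; have csr := p_cross ne_sr; have ctr := p_cross ne_tr.
(* The legs stop just before [Y]; [ds.-1] and [dt.-1] are positive because [1 < ds] and [1 < dt]. *)
apply: (@leg_config_false _ e e_sym e_irr no_theta no_prism Y N k l
  (p s) ds.-1 (p t) dt.-1 (p r) (L r)).
have Ys i d : i <= N -> d <= ds.-1 -> Y i <> p s d /\ (e (Y i) (p s d) ->
    (d = 1 /\ k <= i <= l) \/ (1 < d /\ (i = k \/ i = k.+1))).
  move=> le_i le_d; have [[i_in ->]|[i_in ->]|[i_in ->]] := Y_cases i le_i.
  - by split=> [/p_inj|]; [|rewrite p_adj]; touch_lia.
  - split=> [|adj]; first by apply: g_off; touch_lia.
    by have := g_s _ _ i_in (ltac:(touch_lia) : d <= L s) adj; touch_lia.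
  have [ne adj] := st d (dt + (i - l.+1)) (ltac:(touch_lia)) (ltac:(touch_lia)).
  by split; [exact/nesym | rewrite e_sym => /adj; touch_lia].
have Yt i d : i <= N -> d <= dt.-1 -> Y i <> p t d /\ (e (Y i) (p t d) ->
    (d = 1 /\ k < i <= l.+1) \/ (1 < d /\ (i = l \/ i = l.+1))).
  move=> le_i le_d; have [[i_in ->]|[i_in ->]|[i_in ->]] := Y_cases i le_i.
  - have [ne adj] := ts d (L s - i) (ltac:(touch_lia)) (ltac:(touch_lia)).
    by split; [exact/nesym | rewrite e_sym => /adj; touch_lia].
  - split=> [|adj]; first by apply: g_off; touch_lia.
    by have := g_t _ _ i_in (ltac:(touch_lia) : d <= L t) adj; touch_lia.
  by split=> [/p_inj|]; [|rewrite p_adj]; touch_lia.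
have Yr i d : i <= N -> 0 < d <= L r -> Y i <> p r d /\ (e (Y i) (p r d) ->
    (d = L r /\ (i = 0 \/ i = N)) \/ (d = 1 /\ d < L r /\ k < i <= l)).
  move=> le_i d_in; have [[i_in ->]|[i_in ->]|[i_in ->]] := Y_cases i le_i.
  - have [ne adj] := csr (L s - i) d (ltac:(touch_lia)) d_in.
    by split=> // /adj; touch_lia.
  - split=> [|adj]; first by apply: g_off; touch_lia.
    by have := g_r _ _ i_in d_in adj; touch_lia.
  have [ne adj] := ctr (dt + (i - l.+1)) d (ltac:(touch_lia)) d_in.
  by split=> // /adj; touch_lia.
(* By [Ys], [Yt] and [Yr], a common contact of two of the [a_h] can only be in X. *)
have sq h h' i : h != h' -> i <= N -> k < i <= l -> e (Y i) (p h 1) -> e (Y i) (p h' 1) -> False.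
  move=> ne_h le_i i_in; rewrite Y_g //; apply: one_apex_neighbor ne_h.
  exact: g_M.
split=> //.
- by split; touch_lia.
- by split; touch_lia.
- move=> i j le_i le_j.
  have [[i_in ->]|[i_in ->]|[i_in ->]] := Y_cases i le_i;
  have [[j_in ->]|[j_in ->]|[j_in ->]] := Y_cases j le_j.
  + by move/p_inj; touch_lia.
  + by move=> E; case: (g_off j s (L s - i)); rewrite ?E //; touch_lia.
  + by have [ne _] := cst (L s - i) (dt + (j - l.+1)) ltac:(touch_lia) ltac:(touch_lia).
  + by move=> E; case: (g_off i s (L s - j)); rewrite ?E //; touch_lia.
  + by move/g_inj; touch_lia.
  + by move=> E; case: (g_off i t (dt + (j - l.+1))); rewrite ?E //; touch_lia.
  + have [ne _] := cst (L s - j) (dt + (i - l.+1)) ltac:(touch_lia) ltac:(touch_lia).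
    by move/esym.
  + by move=> E; case: (g_off j t (dt + (i - l.+1))); rewrite ?E //; touch_lia.
  + by move/p_inj; touch_lia.
- move=> i lt_i; have [lt_ik|le_ki] := ltnP i k.
    rewrite !Y_s ?p_adj //; touch_lia.
  have [ik|lt_ki] : i = k \/ k < i by touch_lia.
    rewrite Y_s ?Y_g; [|touch_lia|touch_lia].
    by rewrite ik (_ : L s - k = ds) ?subnn ?addn0 1?e_sym //; touch_lia.
  have [lt_il|le_li] := ltnP i l.
    by rewrite !Y_g ?g_adj; touch_lia.
  have [il|lt_li] : i = l \/ l < i by touch_lia.
    rewrite Y_g ?Y_t; [|touch_lia|touch_lia].
    by rewrite il (_ : x + _ = y) ?subnn ?addn0 //; touch_lia.
  by rewrite !Y_t ?p_adj; touch_lia.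
- rewrite Y_s // Y_t; last by touch_lia.
  by rewrite subn0 (_ : dt + _ = L t) ?base_adj //; touch_lia.
- move=> i j le_i le_j.
  have [[i_in ->]|[i_in ->]|[i_in ->]] := Y_cases i le_i;
  have [[j_in ->]|[j_in ->]|[j_in ->]] := Y_cases j le_j.
  + by rewrite p_adj; touch_lia.
  + by rewrite e_sym => /(g_s _ (L s - i) j_in ltac:(touch_lia)); touch_lia.
  + have [_ adj] := cst (L s - i) (dt + (j - l.+1)) ltac:(touch_lia) ltac:(touch_lia).
    by move/adj; touch_lia.
  + by move/(g_s _ (L s - j) i_in ltac:(touch_lia)); touch_lia.
  + by rewrite g_adj; touch_lia.
  + by move/(g_t _ (dt + (j - l.+1)) i_in ltac:(touch_lia)); touch_lia.
  + have [_ adj] := cst (L s - j) (dt + (i - l.+1)) ltac:(touch_lia) ltac:(touch_lia).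
    by rewrite e_sym => /adj; touch_lia.
  + by rewrite e_sym => /(g_t _ (dt + (i - l.+1)) j_in ltac:(touch_lia)); touch_lia.
  + by rewrite p_adj; touch_lia.
- by rewrite !p0.
- by rewrite !p0.
- by move=> d lt_d; apply: p_step; touch_lia.
- by move=> d lt_d; apply: p_step; touch_lia.
- by move=> d lt_d; apply: p_step; touch_lia.
- by move=> d f le_d le_f; apply: p_inj; touch_lia.
- by move=> d f le_d le_f; apply: p_inj; touch_lia.
- by move=> d f le_d le_f; rewrite p_adj; touch_lia.
- by move=> d f le_d le_f; rewrite p_adj; touch_lia.
- by move=> d f le_d le_f; apply: st; touch_lia.
- by move=> d f le_d le_f; apply: ts; touch_lia.
- by move=> d f le_d le_f; apply: sr; touch_lia.
- by move=> d f le_d le_f; apply: tr; touch_lia.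
- by rewrite Y_s // p_adj; touch_lia.
- by rewrite Y_t // p_adj; touch_lia.
- rewrite Y_s // subn0 Y_t; last by touch_lia.
  by rewrite (_ : dt + _ = L t) ?base_adj //; touch_lia.
- move=> i le_i es et; apply: (sq s t i) => //.
  have := (Ys _ _ le_i (ltac:(touch_lia) : 1 <= ds.-1)).2 es.
  by have := (Yt _ _ le_i (ltac:(touch_lia) : 1 <= dt.-1)).2 et; touch_lia.
- move=> i le_i es er; apply: (sq s r i) => //.
  have := (Ys _ _ le_i (ltac:(touch_lia) : 1 <= ds.-1)).2 es.
  by have := (Yr _ _ le_i (ltac:(touch_lia) : 0 < 1 <= L r)).2 er; touch_lia.
move=> i le_i et er; apply: (sq t r i) => //.
have := (Yt _ _ le_i (ltac:(touch_lia) : 1 <= dt.-1)).2 et.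
by have := (Yr _ _ le_i (ltac:(touch_lia) : 0 < 1 <= L r)).2 er; touch_lia.
Qed.

End Minimal.

(** Induction on [y - x]: a connection that is not minimal contains a strictly shorter one. *)
Lemma no_connection x y (s t : 'I_3) : x <= y -> y <= M -> s != t ->
  touches x s -> touches y t -> False.
Proof.
have [n] := ubnP (y - x); elim: n x y s t => // n IHn x y s t lt_n le_xy le_yM ne_st x_s y_t.
have [r /andP[ne_sr ne_tr]] : exists r, (s != r) && (t != r).
  have /card_gt0P[r r_in] : 0 < #|~: [set s; t]|.
    by rewrite cardsCs setCK card_ord cards2; case: (_ != _).
  by exists r; move: r_in; rewrite !inE negb_or !(eq_sym r).
apply: (@minimal_false x y s t r) => // z z' h h' le_xz le_zz' le_z'y lt_z z_h z'_h'.
apply/eqP/negPn/negP => ne_h.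
by apply: (IHn z z' h h') => //; touch_lia.
Qed.

End PyramidIndices.

(** * From vertex sequences to indexed paths, and the conclusion *)

Lemma induced_path_nth (T : finType) (e : rel T) (u v : T) (q : seq T) :
  induced_path e u v q ->
  [/\ (size q).-1 < size q, nth u q 0 = u, nth u q (size q).-1 = v,
    forall i j, i < size q -> j < size q -> nth u q i = nth u q j -> i = j &
    forall i j, i < size q -> j < size q ->
      e (nth u q i) (nth u q j) = (j == i.+1) || (i == j.+1)].
Proof.
case: q => [[//]|w q] [] [->] vE uq adj; split=> //.
- by rewrite nth_last vE.
- by move=> i j i_lt j_lt /eqP; rewrite nth_uniq // => /eqP.
by move=> i j i_lt j_lt; rewrite adj ?mem_nth // !index_uniq.
Qed.

Theorem theorem8p3 (T : finType) (e : rel T)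
    (e_sym : symmetric e) (e_irr : irreflexive e)
    (GC : in_class_C e)
    (a : T) (b : 'I_3 -> T) (P_ : 'I_3 -> seq T)
    (Sigma : pyramid e a b P_)
    (i j : 'I_3) (i_neq_j : i != j)
    (a_ : 'I_3 -> T) (a_nbr : forall l : 'I_3, a_ l \in P_ l /\ e a (a_ l))
    (u v : T)
    (Pi_u : u \in [set x in P_ i] :\: [set a; a_ i; b i])
    (Pj_v : v \in [set x in P_ j] :\: [set a; a_ j; b j])
    (P : seq T) (P_path : induced_path e u v P) :
  has_neighbor_in e a (interior u v P) \/
  exists l : 'I_3, has_neighbor_in e (b l) (interior u v P).
Proof.
have [/existsP[z /andP[z_in /orP[az|/existsP[h bz]]]]|/existsPn no_nbr] :=
    boolP [exists z, (z \in interior u v P) && (e a z || [exists h, e (b h) z])].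
- by left; exists z.
- by right; exists h, z.
exfalso; case: GC => no_C4 no_theta no_prism _.
case: Sigma => paths disj _ base cross.
pose p h d := nth a (P_ h) d; pose L h := (size (P_ h)).-1.
have L_size h d : (d < size (P_ h)) = (d <= L h).
  have [gt0 _ _ _ _] := induced_path_nth (paths h).
  by rewrite /L; case: (size _) gt0.
have p0 h : p h 0 = a by have [_ E _ _ _] := induced_path_nth (paths h).
have pL h : p h (L h) = b h by have [_ _ E _ _] := induced_path_nth (paths h).
have p_inj h d f : d <= L h -> f <= L h -> p h d = p h f -> d = f.
  by rewrite -!L_size; have [_ _ _ inj _] := induced_path_nth (paths h); apply: inj.
have p_adj h d f : d <= L h -> f <= L h ->
    e (p h d) (p h f) = (f == d.+1) || (d == f.+1).
  by rewrite -!L_size; have [_ _ _ _ adj] := induced_path_nth (paths h); apply: adj.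
have p_onto h x : x \in P_ h -> exists2 d, d <= L h & x = p h d.
  by case/(nthP a) => d; rewrite L_size => le_d <-; exists d.
have p_in h d : 0 < d <= L h -> p h d \in [set x in P_ h] :\ a.
  case/andP=> d_gt le_d; rewrite !inE mem_nth ?L_size // andbT.
  by apply/eqP; rewrite -(p0 h) => /p_inj; lia.
have a1 h : a_ h = p h 1 /\ 0 < L h.
  have [/p_onto[d le_d ->]] := a_nbr h.
  by rewrite -(p0 h) p_adj // => /orP[/eqP dE|//]; rewrite dE in le_d *.
have p_cross (h h' : 'I_3) d f : h != h' -> 0 < d <= L h -> 0 < f <= L h' ->
    p h d <> p h' f /\ (e (p h d) (p h' f) -> d = L h /\ f = L h').
  move=> ne_h d_in f_in; have pd := p_in h d d_in; have pf := p_in h' f f_in.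
  split=> [E|adj].
    by have /pred0P/(_ (p h d)) := disj _ _ ne_h; rewrite /= pd E pf.
  have [] := cross _ _ _ _ ne_h pd pf adj; rewrite -!pL.
  case/andP: d_in f_in => _ le_d /andP[_ le_f] /p_inj dE /p_inj fE.
  by split; [apply: dE | apply: fE].
have base_adj (h h' : 'I_3) : h != h' -> e (p h (L h)) (p h' (L h')).
  by move=> ne_h; rewrite !pL; apply: base.
have inner h w : w \in [set x in P_ h] :\: [set a; a_ h; b h] ->
    exists2 d, 1 < d < L h & w = p h d.
  rewrite !inE !negb_or => /andP[/andP[/andP[/eqP wa /eqP w1] /eqP wb] /p_onto[d le_d wE]].
  exists d => //; subst w.
  have d0 : d <> 0 by move=> dE; rewrite dE p0 in wa.
  have d1 : d <> 1 by move=> dE; rewrite dE (a1 h).1 in w1.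
  have dL : d <> L h by move=> dE; rewrite dE pL in wb.
  by lia.
have [du du_in uE] := inner _ _ Pi_u; have [dv dv_in vE] := inner _ _ Pj_v.
have [ne_uv nadj_uv] : u <> v /\ ~ e u v.
  have [ne adj] := p_cross i j du dv i_neq_j ltac:(lia) ltac:(lia).
  by rewrite uE vE; split=> // /adj; lia.
have [P_gt P0 Plast P_inj P_adj] := induced_path_nth P_path.
(* As [u] and [v] are distinct and non-adjacent, [P] has at least three vertices; the index of [g]
   is shifted by one because position 0 is [u]. *)
have [M sizeP] : exists M, size P = M.+3.
  case sz: (size P) P_gt Plast P_adj => [|[|[|M]]] // _; last by exists M.
    by rewrite P0.
  by move=> v1 /(_ 0 1 isT isT); rewrite P0 v1 => /nadj_uv.
rewrite sizeP /= in P_inj P_adj Plast.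
pose g z := nth u P z.+1.
have g_in z : z <= M -> g z \in interior u v P.
  move=> le_z; rewrite !inE mem_nth ?sizeP //=; last by lia.
  apply/andP; split; apply/eqP => gE.
    by rewrite -P0 in gE; have := P_inj _ _ _ _ gE; lia.
  by rewrite -Plast in gE; have := P_inj _ _ _ _ gE; lia.
have g_far z : z <= M -> ~ e (g z) a /\ forall h, ~ e (g z) (p h (L h)).
  move=> le_z; have := no_nbr (g z); rewrite g_in //= negb_or negb_exists.
  case/andP=> /negP na /forallP nb; split; first by rewrite e_sym.
  by move=> h; rewrite e_sym pL; apply/negP.
have g_adj z z' : z <= M -> z' <= M -> e (g z) (g z') = (z' == z.+1) || (z == z'.+1).
  by move=> le_z le_z'; rewrite P_adj //; lia.
have g_u : e (g 0) u by rewrite -P0 P_adj.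
have g_v : e (g M) v by rewrite -Plast P_adj //; lia.
have before z : z <= M -> z = 0 \/ exists2 z', z' <= M & e (g z') (g z).
  case: z => [|z] le_z; first by left.
  by right; exists z; rewrite ?g_adj ?eqxx //; lia.
apply: (@no_connection T e e_sym e_irr no_C4 no_theta no_prism a p L
  (fun h => (a1 h).2) p0 p_inj p_adj p_cross base_adj g M _ _ _ _ 0 M i j) => //.
- by move=> z z' le_z le_z' /P_inj; lia.
(* If [a] were in the interior, its predecessor on [P] would be an interior neighbor of [a], which
   is excluded, or [u], which is not adjacent to [a]. *)
- move=> z le_z; split; last exact: (g_far z le_z).1.
  move=> gE; case: (before z le_z) => [z0|[z' le_z' adj]]; last first.
    by rewrite gE in adj; case: (g_far z' le_z').
  by move: g_u; rewrite -z0 gE uE -(p0 i) p_adj; lia.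
(* A base vertex in the interior has no interior neighbor, so it would be the whole interior and see
   both [u] and [v], one of which is on a leg other than [P_h]. *)
- move=> z h le_z; split; last exact: (g_far z le_z).2.
  move=> gE; case: (before z le_z) => [z0|[z' le_z' adj]]; last first.
    by rewrite gE in adj; case: (g_far z' le_z') => _ /(_ h).
  have [lt_zM|zM] : z < M \/ z = M by lia.
    have := g_adj z.+1 z lt_zM le_z; rewrite eqxx orbT gE => adj.
    by case: (g_far z.+1 lt_zM) => _ /(_ h).
  have Lh := (a1 h).2.
  have [hi|ne_hi] := eqVneq h i.
    have [_ adj] := p_cross h j (L h) dv ltac:(by rewrite hi) ltac:(lia) ltac:(lia).
    by move: g_v; rewrite -zM gE vE => /adj; lia.
  have [_ adj] := p_cross h i (L h) du ne_hi ltac:(lia) ltac:(lia).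
  by move: g_u; rewrite -z0 gE uE => /adj; lia.
- by apply/touchesP; exists du; rewrite // -uE.
by apply/touchesP; exists dv; rewrite // -vE.
Qed.
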